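(* Let $\theta_1,\dots,\theta_r$ be real numbers, with the random variable $Z_\theta$ as defined in the context. Let $f_1,\dots,f_D\in\mathbb{C}(X_1,\dots,X_r)$ be real-valued and without poles on $\mathbb{T}^r$, and let $F_j:t\mapsto f_j(e^{i\theta_1t},\dots,e^{i\theta_rt})$ for $1\le j\le D$. Then $$\frac1X\int_0^X\mathbf{1}_{x_1>\dots>x_D}\left(F_1(y),\dots,F_D(y)\right)\mathrm{d}y\underset{X\to+\infty}{\longrightarrow}\mathbb{P}\left(f_1(Z_\theta)>\dots>f_D(Z_\theta)\right).$$
   Context: $\mathbb{T}=\{z\in\mathbb{C}:|z|=1\}$; $\mathbf{1}_{x_1>\dots>x_D}$ is the indicator function of $\{(x_1,\dots,x_D)\in\mathbb{R}^D : x_1>\dots>x_D\}$. A rational function has no pole on $\mathbb{T}^r$ if it can be written $P/Q$ with polynomials $P,Q$ such that $Q$ does not vanish on $\mathbb{T}^r$; it is real-valued on $\mathbb{T}^r$ if it takes real values there. Let $m=\dim_{\mathbb{Q}}\mathrm{Span}_{\mathbb{Q}}(\theta_1,\dots,\theta_r)$. After reindexing the $\theta_i$ (and correspondingly the variables $X_i$), it is assumed that $\{\theta_1,\dots,\theta_m\}$ is a basis of this $\mathbb{Q}$-vector space, and one writes $\theta_j=\sum_{k=1}^m b_{k,j}\theta_k$ for $m+1\le j\le r$, with $b_{k,j}\in\mathbb{Q}$. Let $d\ge1$ be the least common multiple of the denominators of all the $b_{k,j}$ ($d=1$ if $m=r$), and $h_{k,j}=d\,b_{k,j}\in\mathbb{Z}$.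 Then $Z_\theta=\left(Z_1^d,\dots,Z_m^d,\prod_{k=1}^mZ_k^{h_{k,m+1}},\dots,\prod_{k=1}^mZ_k^{h_{k,r}}\right)$ where $Z_1,\dots,Z_m$ are independent uniform random variables on $\mathbb{T}$. *)

(* Defs.v *)
From HB Require Import structures.
From mathcomp Require Import all_boot all_order all_algebra.
From mathcomp Require Import complex.
(* the notations of mpoly clash with those of mathcomp-analysis *)
From mathcomp Require Import -(notations) mpoly.
From mathcomp Require Import all_classical all_reals all_analysis.

Set Implicit Arguments.
Unset Strict Implicit.
Unset Printing Implicit Defensive.

Import Order.TTheory GRing.Theory Num.Theory.
Import numFieldNormedType.Exports.

Local Open Scope classical_set_scope.
Local Open Scope ring_scope.
Local Open Scope complex_scope.

Section RationalFunctions.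
Variables (R : realType) (r : nat).

Definition cpoly := mpoly r R[i].

Definition ratfun := {fraction cpoly}.

Definition quotient_of (f : ratfun) (P Q : cpoly) : Prop :=
  f = FracField.tofrac P / FracField.tofrac Q.

(* The value at z of any representation of f whose denominator does not vanish
   at z (it does not depend on the representation); 0 if z is a pole of f. *)
Definition rateval (f : ratfun) (z : 'I_r -> R[i]) : R[i] :=
  xget 0 [set w | exists P Q : cpoly, [/\ quotient_of f P Q,
    meval z Q != 0 & w = meval z P / meval z Q]].

Definition torus : set ('I_r -> R[i]) := [set z | forall k, `|z k| = 1].

Definition no_pole_on_torus (f : ratfun) : Prop :=
  exists P Q : cpoly, quotient_of f P Q /\
    forall z, torus z -> meval z Q != 0.

Definition real_on_torus (f : ratfun) : Prop :=
  forall z, torus z -> rateval f z \is Num.real.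

End RationalFunctions.

Section ComplexRandomVariables.
Variable R : realType.

Definition expi (t : R) : R[i] := cos t +i* sin t.

Lemma two_pi_gt0 : 0 < pi *+ 2 :> R.
Proof. by rewrite mulrn_wgt0 // pi_gt0. Qed.

Definition borelC := g_sigma_algebraType (@open R[i]^o).

Variables (d : measure_display) (W : measurableType d) (P : probability W R).

(* The uniform law on the unit circle is the law of e^(it), with t uniform on
   [0, 2 pi]. *)
Definition uniform_on_circle (Z : {RV P >-> borelC}) : Prop :=
  (forall w, `|Z w : R[i]| = 1) /\
  forall A : set borelC, measurable A ->
    distribution P Z A = uniform_prob two_pi_gt0 (expi @^-1` A).

Definition mutually_independent (I : finType) d' (T : measurableType d')
    (Z : I -> {RV P >-> T}) : Prop :=
  forall (J : {set I}) (A : I -> set T), (forall k, measurable (A k)) ->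
    P (\bigcap_(k in [set` J]) Z k @^-1` A k) =
    (\prod_(k in J) P (Z k @^-1` A k))%E.

End ComplexRandomVariables.

Section Ztheta.
Variable R : realType.

Definition Qspan n (v : 'I_n -> R) : set R :=
  [set x | exists c : 'I_n -> rat, x = \sum_k ratr (c k) * v k].

Definition Qfree n (v : 'I_n -> R) : Prop :=
  forall c : 'I_n -> rat, \sum_k ratr (c k) * v k = 0 -> forall k, c k = 0.

Definition Qbasis n (v : 'I_n -> R) (V : set R) : Prop :=
  Qfree v /\ Qspan v = V.

Variables m s : nat.

Definition common_den (b : 'M[rat]_(m, s)) : nat :=
  \big[lcmn/1%N]_(k < m) \big[lcmn/1%N]_(j < s) `|denq (b k j)|%N.

(* common_den b * b k j is an integer, hence equal to its numerator *)
Definition scaled_coef (b : 'M[rat]_(m, s)) (k : 'I_m) (j : 'I_s) : int :=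
  numq ((common_den b)%:R * b k j).

Definition Ztheta (b : 'M[rat]_(m, s)) (z : 'I_m -> R[i]) : 'I_(m + s) -> R[i] :=
  fun i => match fintype.split i with
           | inl k => z k ^+ common_den b
           | inr j => \prod_(k < m) z k ^ scaled_coef b k j
           end.

End Ztheta.

Definition decreasing_tuples {R : realType} {D : nat} : set ('I_D -> R) :=
  [set x | forall i j : 'I_D, (i < j)%N -> x i > x j].

(* Main.v *)
Require Import Defs.
From HB Require Import structures.
From mathcomp Require Import all_boot all_order all_algebra.
From mathcomp Require Import complex.
From mathcomp Require Import -(notations) mpoly.
From mathcomp Require Import all_classical all_reals all_analysis.
From mathcomp Require Import measurable_realfun ring lra zify.

Set Implicit Arguments.
Unset Strict Implicit.
Unset Printing Implicit Defensive.

Import Order.TTheory GRing.Theory Num.Theory.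
Import numFieldNormedType.Exports.

Local Open Scope classical_set_scope.
Local Open Scope ring_scope.
Local Open Scope complex_scope.

(** The inequality f_i > f_j at a point of the torus is the inequality p > 0 for
    the real trigonometric polynomial p = Re ((P_i Q_j - P_j Q_i) conj (Q_i Q_j)),
    which is |Q_i Q_j|^2 (f_i - f_j) with f_i = P_i / Q_i. Composed with the map
    z |-> Z_theta, it is a trigonometric polynomial in m variables, the curve
    y |-> (e^(i theta_1 y), ..., e^(i theta_r y)) becomes the linear flow on T^m
    with the rationally independent frequencies theta_k / d, and everything
    reduces to the following: if p_1, ..., p_l are real trigonometric polynomials
    on T^m, the proportion of time during which they are all positive along the
    flow converges to the probability that they are all positive at a uniform
    point (lemma time_average_positive).

    A trigonometric polynomial has the same mean along the flow as at the uniform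
    point, namely its constant coefficient: every other character averages to 0 on
    both sides. Along the flow this is an explicit integral, since its frequency
    is nonzero by rational independence (flow_character_average). For
    the uniform point it is the independence of the coordinates together with
    the vanishing of the mean of z^e on the circle for e <> 0. Independence being
    a statement about events, each coordinate is first replaced by a nearby
    function with finitely many values, for which the mean of a product is
    a finite sum that factors (independent_centered_characters).

    It remains to pass from trigonometric polynomials to indicator functions.
    The iterates of w |-> (3 w - w^3) / 2 are polynomials that approximate the sign
    of x on [-1, 1] with an error at most (1 - x^2)^(2^k) (step_approx). Replacing each
    indicator of p_i > 0 by such a polynomial in p_i costs at most
    the sum of the (1 - p_i^2)^(2^k), again a trigonometric polynomial, so that both
    the approximation and its error are controlled by means
    (integral_positive_all_close). The mean of the error
    tends to the sum of the P (p_i = 0) as k grows.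

    Finally a real trigonometric polynomial p that is not identically 0 on the torus
    vanishes with probability 0 (zero_set_null). Means of trigonometric polynomials are
    invariant under rotation, hence so is P (p = 0), which is a limit of such means.
    In a well chosen integer direction v, the function
    x |-> p (z x^v) is for every z a nonzero Laurent polynomial in x, with a number of
    roots bounded independently of z (trig_root_bound). Adding up the
    probabilities P (p (z x^v) = 0), all equal to P (p = 0), over K points x of the
    circle gives K P (p = 0) <= B for all K. If some p_i is identically 0, then
    both sides of the limit are 0. *)

(** * Polynomial approximation of the step function *)

Section Smoothing.
Variable R : realFieldType.
Implicit Types x w : R.

Fixpoint sgn_approx (n : nat) x : R :=
  if n is k.+1 then let w := sgn_approx k x in (3 * w - w ^+ 3) / 2 else x.

(** The step rests on the identity
    1 - ((3 w - w^3) / 2)^2 = (1 - w^2)^2 (4 - w^2) / 4: the distance of w^2 to 1 is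
    at least squared at every iteration. *)
Lemma sgn_approx_bound n x : `|x| <= 1 ->
  `|sgn_approx n x| <= 1 /\ 1 - sgn_approx n x ^+ 2 <= (1 - x ^+ 2) ^+ (2 ^ n).
Proof.
move=> x1; elim: n => [|n [w1 IH]] /=; first by rewrite expr1.
set w := sgn_approx n x in w1 IH *.
have w2 : w ^+ 2 <= 1 by rewrite -[leRHS](expr1n _ 2) -(real_normK (num_real w)) ler_sqr ?nnegrE.
have E : 1 - ((3 * w - w ^+ 3) / 2) ^+ 2 = (1 - w ^+ 2) ^+ 2 * ((4 - w ^+ 2) / 4).
  by field.
split.
  rewrite -(@ler_sqr _ `|_|) ?nnegrE // expr1n real_normK ?num_real // -subr_ge0 E.
  by rewrite mulr_ge0 ?sqr_ge0 // divr_ge0 //; lra.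
rewrite E expnS mulnC exprM.
apply: (@le_trans _ _ ((1 - w ^+ 2) ^+ 2)).
  rewrite -[leRHS]mulr1 ler_wpM2l ?sqr_ge0 // ler_pdivrMr //.
  by have := sqr_ge0 w; lra.
by rewrite ler_sqr ?nnegrE ?(le_trans _ IH) //; lra.
Qed.

Lemma sgn_approx_sign n x : `|x| <= 1 ->
  (0 < x -> 0 <= sgn_approx n x) /\ (x <= 0 -> sgn_approx n x <= 0).
Proof.
move=> x1; elim: n => [|n [IHp IHn]] /=; first by split=> // /ltW.
have [w1 _] := sgn_approx_bound n x1.
set w := sgn_approx n x in w1 IHp IHn *.
have w2 : w ^+ 2 <= 1 by rewrite -[leRHS](expr1n _ 2) -(real_normK (num_real w)) ler_sqr ?nnegrE.
have -> : (3 * w - w ^+ 3) / 2 = w * ((3 - w ^+ 2) / 2) by field.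
by split=> [/IHp|/IHn] hw; [apply: mulr_ge0 | apply: mulr_le0_ge0] => //; lra.
Qed.

(** At x = 0 the approximation is 1/2 and the bound is 1; for x <> 0 the bound
    tends to 0, since sgn_approx k x has the sign of x and a square close to 1. *)
Lemma step_approx n x : `|x| <= 1 ->
  `|(0 < x)%R%:R - (1 + sgn_approx n x) / 2| <= (1 - x ^+ 2) ^+ (2 ^ n).
Proof.
move=> x1; have [w1 wb] := sgn_approx_bound n x1.
have [wp wn] := sgn_approx_sign n x1.
apply: le_trans wb; move: w1 wp wn; set w := sgn_approx n x => w1 wp wn.
move: w1; rewrite ler_norml => /andP[w1 w1'].
case: ltrP => [/wp|/wn] w0 /=.
  by rewrite ger0_norm; nra.
by rewrite mulr0n ler0_norm; nra.
Qed.

Lemma step_approx_unit n x : `|x| <= 1 -> 0 <= (1 + sgn_approx n x) / 2 <= 1.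
Proof.
move=> x1; have [+ _] := sgn_approx_bound n x1.
by rewrite ler_norml => /andP[? ?]; apply/andP; split; lra.
Qed.

End Smoothing.

(** By telescoping, replacing one factor at a time. *)
Lemma prod_diff_le (K : numDomainType) (I : Type) (r : seq I) (a b : I -> K) :
  (forall i, `|a i| <= 1) -> (forall i, `|b i| <= 1) ->
  `|\prod_(i <- r) a i - \prod_(i <- r) b i| <= \sum_(i <- r) `|a i - b i|.
Proof.
move=> a1 b1; elim: r => [|i r IH]; first by rewrite !big_nil subrr normr0.
rewrite !big_cons; set A := \prod_(j <- r) a j in IH *; set B := \prod_(j <- r) b j in IH *.
have A1 : `|A| <= 1.
  by rewrite normr_prod; apply: numdomain.Num.Theory.prodr_ile1 => j _; rewrite normr_ge0 a1.
have -> : a i * A - b i * B = (a i - b i) * A + b i * (A - B).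
  by rewrite mulrBl mulrBr addrA subrK.
apply: le_trans (ler_normD _ _) _; rewrite !normrM lerD //.
  by rewrite ler_piMr.
by apply: le_trans IH; rewrite ler_piMl.
Qed.

(** * The unit circle *)

Section Circle.
Variable R : realType.
Local Notation C := R[i].

Lemma norm_expi (t : R) : `|expi t| = 1.
Proof. by rewrite normc_def /= cos2Dsin2 sqrtr1. Qed.

Lemma expi_neq0 (t : R) : expi t != 0.
Proof. by rewrite -normr_eq0 norm_expi oner_eq0. Qed.

Lemma expiD (x y : R) : expi (x + y) = expi x * expi y.
Proof.
by rewrite /expi cosD sinD; apply/eqP; rewrite eq_complex; apply/andP; split;
   apply/eqP => /=; ring.
Qed.

Lemma expi0 : expi (0 : R) = 1.
Proof. by rewrite /expi cos0 sin0. Qed.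

Lemma expiN (x : R) : expi (- x) = (expi x)^-1.
Proof.
by apply: (mulfI (expi_neq0 x)); rewrite -expiD subrr expi0 mulfV ?expi_neq0.
Qed.

Lemma expiMn (x : R) n : expi (x *+ n) = expi x ^+ n.
Proof.
by elim: n => [|n IH]; rewrite ?mulr0n ?expi0 // mulrS exprS expiD IH.
Qed.

Lemma expiMz (x : R) (n : int) : expi (x *~ n) = expi x ^ n.
Proof. by case: n => n; rewrite ?NegzE ?mulrNz ?expiN -?pmulrn ?expiMn // . Qed.

Lemma expi_sum (I : Type) (r : seq I) (x : I -> R) :
  expi (\sum_(i <- r) x i) = \prod_(i <- r) expi (x i).
Proof.
elim: r => [|i r IH]; first by rewrite !big_nil expi0.
by rewrite !big_cons expiD IH.
Qed.

(** Conjugation is inversion on the circle, so that negative powers are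
    conjugates of positive ones and stay within the polynomials in z and its conjugate. *)
Lemma conjc_unit (z : C) : `|z| = 1 -> conjc z = z^-1.
Proof.
move=> z1; have z0 : z != 0 by rewrite -normr_eq0 z1 oner_eq0.
by apply: (mulfI z0); rewrite mulfV // -[RHS](expr1n _ 2) -z1 -normCK.
Qed.

Lemma Re_mulr_real (c : C) (x : R) : complex.Re (c * x%:C) = complex.Re c * x.
Proof. by case: c => a b /=; rewrite mulr0 subr0. Qed.

Lemma norm_Re_mul (c x : C) (e : R) : `|x| <= e%:C ->
  `|complex.Re (c * x)| <= complex.Re `|c| * e.
Proof.
move=> xe; rewrite -lecR; apply: le_trans (normc_ge_Re _) _.
rewrite normrM; apply: le_trans (ler_wpM2l (normr_ge0 c) xe) _.
by rewrite -{1}[`|c|]RRe_real ?normr_real // -(rmorphM (real_complex R)).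
Qed.

End Circle.

(** * Trigonometric polynomials on the torus *)

Section Trig.
Variables (R : realType) (m : nat).
Local Notation C := R[i].
Local Notation freq := {ffun 'I_m -> int}.
Implicit Types (z x : 'I_m -> C) (n : freq) (g h : ('I_m -> C) -> C).

(** The character of the torus with frequency vector n. *)
Definition mon z n : C := \prod_k z k ^ n k.

Lemma torus_neq0 z k : torus z -> z k != 0.
Proof. by move=> tz; rewrite -normr_eq0 tz oner_eq0. Qed.

Lemma torusM z x : torus z -> torus x -> torus (fun k => z k * x k).
Proof. by move=> tz tx k; rewrite normrM tz tx mulr1. Qed.

Lemma torus_expi (t : 'I_m -> R) : torus (fun k => expi (t k)).
Proof. by move=> k; rewrite norm_expi. Qed.

Lemma norm_exprz (y : C) (e : int) : `|y| = 1 -> `|y ^ e| = 1.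
Proof.
by move=> y1; case: e => e; rewrite ?NegzE -?exprnN ?normrV ?normrX ?y1 ?expr1n ?invr1 // unitfE
  expf_neq0 // -normr_eq0 y1 oner_eq0.
Qed.

Lemma norm_mon z n : torus z -> `|mon z n| = 1.
Proof.
by move=> tz; rewrite normr_prod big1 // => k _; rewrite norm_exprz.
Qed.

Lemma mon0 z : mon z 0 = 1.
Proof. by rewrite /mon big1 // => k _; rewrite ffunE expr0z. Qed.

Lemma monD z n n' : torus z -> mon z (n + n') = mon z n * mon z n'.
Proof.
move=> tz; rewrite /mon -big_split /=; apply: eq_bigr => k _.
by rewrite ffunE expfzDr // torus_neq0.
Qed.

Lemma monN z n : torus z -> mon z (- n) = (mon z n)^*%C.
Proof.
move=> tz; rewrite /mon rmorph_prod; apply: eq_bigr => k _.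
rewrite ffunE -exprz_inv -(conjc_unit (tz k)).
exact/esym/(fmorphXz (conjc (R:=R))).
Qed.

Lemma monM z x n : mon (fun k => z k * x k) n = mon z n * mon x n.
Proof. by rewrite /mon -big_split /=; apply: eq_bigr => k _; rewrite expfzMl. Qed.

Lemma mon_expi (t : 'I_m -> R) n :
  mon (fun k => expi (t k)) n = expi (\sum_k t k *~ n k).
Proof. by rewrite expi_sum; apply: eq_bigr => k _; rewrite expiMz. Qed.

Lemma mon_power (y : C) (v : 'I_m -> int) n : y != 0 ->
  mon (fun k => y ^ v k) n = y ^ (\sum_k v k * n k).
Proof.
move=> y0; have bm := big_morph (fun e : int => y ^ e)
  (fun a b => expfzDr a b y0) (expr0z y).
by rewrite bm; apply: eq_bigr => k _; rewrite exprz_exp.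
Qed.

Definition trigsum (s : seq (C * freq)) z : C := \sum_(a <- s) a.1 * mon z a.2.

(** The equality is asked for on the torus only: conjugation acts on
    characters by negating the frequency only there. *)
Definition trigpoly g : Prop :=
  exists s, forall z, torus z -> g z = trigsum s z.

Lemma eq_trigpoly g h : (forall z, torus z -> g z = h z) ->
  trigpoly h -> trigpoly g.
Proof. by move=> gh [s hs]; exists s => z tz; rewrite gh // hs. Qed.

Lemma trigpoly_mon n : trigpoly (mon^~ n).
Proof. by exists [:: (1, n)] => z _; rewrite /trigsum big_seq1 mul1r. Qed.

Lemma trigpoly_cst c : trigpoly (fun=> c).
Proof. by exists [:: (c, 0)] => z _; rewrite /trigsum big_seq1 mon0 mulr1. Qed.

Lemma trigpolyD g h : trigpoly g -> trigpoly h -> trigpoly (fun z => g z + h z).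
Proof.
by move=> [s gs] [s' hs]; exists (s ++ s') => z tz; rewrite gs // hs // /trigsum big_cat.
Qed.

Lemma trigpolyM g h : trigpoly g -> trigpoly h -> trigpoly (fun z => g z * h z).
Proof.
move=> [s gs] [s' hs].
exists [seq (a.1 * a'.1, a.2 + a'.2) | a <- s, a' <- s'] => z tz.
rewrite gs // hs // /trigsum big_allpairs_dep /= mulr_suml; apply: eq_bigr => a _.
by rewrite mulr_sumr; apply: eq_bigr => a' _; rewrite monD // mulrACA.
Qed.

Lemma trigpoly_conj g : trigpoly g -> trigpoly (fun z => (g z)^*%C).
Proof.
move=> [s gs]; exists [seq (a.1^*%C, - a.2) | a <- s] => z tz.
rewrite gs // /trigsum raddf_sum big_map; apply: eq_bigr => a _.
by rewrite monN //; exact: (rmorphM (conjc (R:=R))).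
Qed.

Lemma trigpoly_sum (I : Type) (r : seq I) (g : I -> ('I_m -> C) -> C) :
  (forall i, trigpoly (g i)) -> trigpoly (fun z => \sum_(i <- r) g i z).
Proof.
move=> gt; elim: r => [|i r IH].
  by apply: eq_trigpoly (trigpoly_cst 0) => z _; rewrite big_nil.
by apply: eq_trigpoly (trigpolyD (gt i) IH) => z _; rewrite big_cons.
Qed.

Lemma trigpoly_prod (I : Type) (r : seq I) (g : I -> ('I_m -> C) -> C) :
  (forall i, trigpoly (g i)) -> trigpoly (fun z => \prod_(i <- r) g i z).
Proof.
move=> gt; elim: r => [|i r IH].
  by apply: eq_trigpoly (trigpoly_cst 1) => z _; rewrite big_nil.
by apply: eq_trigpoly (trigpolyM (gt i) IH) => z _; rewrite big_cons.
Qed.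

Lemma trigpolyX g k : trigpoly g -> trigpoly (fun z => g z ^+ k).
Proof.
move=> gt; apply: eq_trigpoly (trigpoly_prod (iota 0 k) (fun=> gt)) => z _.
by rewrite big_const_seq count_predT size_iota iter_mulr_1.
Qed.

Definition rtrig (p : ('I_m -> C) -> R) : Prop := trigpoly (fun z => (p z)%:C).

Lemma rtrig_Re g : trigpoly g -> rtrig (fun z => complex.Re (g z)).
Proof.
move=> gt; apply: eq_trigpoly (trigpolyM (trigpoly_cst 2^-1)
  (trigpolyD gt (trigpoly_conj gt))) => z _.
case: (g z) => a b; apply: (@mulfI _ 2); first by rewrite pnatr_eq0.
rewrite mulrA mulfV ?pnatr_eq0 // mul1r mulr_natl mulr2n.
by apply/eqP; rewrite eq_complex /= subrr addr0 !eqxx.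
Qed.

Lemma rtrig_cst c : rtrig (fun=> c). Proof. exact: trigpoly_cst. Qed.

Lemma rtrigD p q : rtrig p -> rtrig q -> rtrig (fun z => p z + q z).
Proof.
move=> pt qt; apply: eq_trigpoly (trigpolyD pt qt) => z _.
by rewrite rmorphD.
Qed.

Lemma rtrigM p q : rtrig p -> rtrig q -> rtrig (fun z => p z * q z).
Proof.
move=> pt qt; apply: eq_trigpoly (trigpolyM pt qt) => z _.
by rewrite rmorphM.
Qed.

Lemma rtrigN p : rtrig p -> rtrig (fun z => - p z).
Proof.
move=> pt; apply: eq_trigpoly (rtrigM (rtrig_cst (- 1)) pt) => z _.
by rewrite mulN1r.
Qed.

Lemma rtrigX p k : rtrig p -> rtrig (fun z => p z ^+ k).
Proof.
by move=> pt; apply: eq_trigpoly (trigpolyX k pt) => z _; rewrite rmorphXn.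
Qed.

Lemma rtrig_prod (I : Type) (r : seq I) (p : I -> ('I_m -> C) -> R) :
  (forall i, rtrig (p i)) -> rtrig (fun z => \prod_(i <- r) p i z).
Proof.
by move=> pt; apply: eq_trigpoly (trigpoly_prod r pt) => z _; rewrite rmorph_prod.
Qed.

Lemma rtrig_bounded p : rtrig p ->
  exists2 M, 0 < M & forall z, torus z -> `|p z| <= M.
Proof.
move=> [s ps]; exists (1 + \sum_(a <- s) complex.Re `|a.1|).
  rewrite ltr_pwDl // sumr_ge0 // => a _.
  by rewrite normc_def /= sqrtr_ge0.
move=> z tz; apply: (@le_trans _ _ (\sum_(a <- s) complex.Re `|a.1|)); last by rewrite lerDr.
rewrite -lecR.
have -> : (`|p z|)%:C = `|(p z)%:C| :> C.
  by rewrite normc_def /= expr0n addr0 sqrtr_sqr.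
rewrite ps // rmorph_sum /=; apply: le_trans (ler_norm_sum _ _ _) _.
apply: ler_sum => a _; rewrite normrM norm_mon // mulr1.
case: (a.1) => x y; rewrite normc_def /=; exact: lexx.
Qed.

(** Gathering the terms of equal frequency. When all the coefficients cancel, the
    list of frequencies is empty and g vanishes on the torus. *)
Lemma trigpoly_collect g : trigpoly g ->
  exists (S : seq freq) (c : freq -> C), [/\ uniq S, forall n, n \in S -> c n != 0 &
    forall z, torus z -> g z = \sum_(n <- S) c n * mon z n].
Proof.
move=> [s gs]; pose c n := \sum_(a <- s | a.2 == n) a.1.
exists [seq n <- undup (map snd s) | c n != 0], c; split.
- by rewrite filter_uniq // undup_uniq.
- by move=> n; rewrite mem_filter => /andP[].
move=> z tz; rewrite gs // big_filter [RHS]big_mkcond /=.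
rewrite [RHS](_ : _ =
    \sum_(n <- undup (map snd s)) \sum_(a <- s | a.2 == n) a.1 * mon z n); last first.
  apply: eq_bigr => n _; rewrite -mulr_suml -/(c n).
  by case: eqP => //= ->; rewrite mul0r.
rewrite (exchange_big_dep xpredT) //= /trigsum big_seq [RHS]big_seq.
apply: eq_bigr => a sa; rewrite big_mkcond.
rewrite (bigD1_seq a.2) ?undup_uniq ?mem_undup ?map_f //= eqxx.
by rewrite big1 ?addr0 // => n /negbTE na; rewrite eq_sym na.
Qed.

(** Take v_k = K^k: each condition says that K is not a root of
    a certain nonzero integer polynomial, and finitely many such polynomials have
    a common natural number K outside their roots. *)
Lemma separating_direction (S : seq freq) n0 :
  exists v : 'I_m -> int, forall n, n \in S -> n != n0 ->
    \sum_k v k * n k != \sum_k v k * n0 k.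
Proof.
pose q n : {poly int} := \sum_(k < m) (n k - n0 k)%:P * 'X^k.
have qE n (K : int) : (q n).[K] = \sum_(k < m) K ^+ k * n k - \sum_(k < m) K ^+ k * n0 k.
  rewrite horner_sum -sumrB; apply: eq_bigr => k _.
  by rewrite hornerM hornerC hornerXn mulrC mulrBr.
have q0 n : n != n0 -> q n != 0.
  apply: contraNneq => /polyP qn; apply/eqP/ffunP => k; move: (qn k).
  rewrite coef_sum coef0 (bigD1 k) //= coefCM coefXn eqxx mulr1 big1.
    by rewrite addr0 => /eqP; rewrite subr_eq0 => /eqP.
  move=> j jk; rewrite coefCM coefXn (_ : _ == _ = false) ?mulr0 //.
  by apply/negbTE; apply: contraNneq jk => kj; apply/eqP/val_inj.
pose Q := \prod_(n <- S | n != n0) q n.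
have Q0 : Q != 0 by rewrite prodf_seq_neq0; apply/allP => n _; apply/implyP/q0.
have [K QK] : exists K : nat, Q.[K%:Z] != 0.
  apply/not_existsP => H.
  have /(max_poly_roots Q0) : all (root Q) [seq k%:Z | k <- iota 0 (size Q)].
    by apply/allP => _ /mapP[k _ ->]; apply/negPn/negP => /H.
  by rewrite size_map size_iota ltnn map_inj_uniq ?iota_uniq => [/(_ isT)|a b []].
exists (fun k : 'I_m => K%:Z ^+ k) => n nS nn0; apply: contraNneq QK => E.
rewrite horner_prod prodf_seq_eq0; apply/hasP; exists n => //=.
by rewrite nn0 qE E subrr eqxx.
Qed.

(** Along the curve y |-> z y^v the sum becomes a Laurent polynomial in y, whose
    coefficient at the exponent of n0 is c n0 z^n0, up to a shift: no other
    frequency in S has the same exponent. As |z^n0| = 1, the coefficient is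
    nonzero whatever z is, and the degree depends on S and v only. *)
Lemma trig_root_bound (S : seq freq) (c : freq -> C) n0 :
  uniq S -> n0 \in S -> c n0 != 0 ->
  exists (v : 'I_m -> int) (B : nat), forall z, torus z ->
    forall xs : seq C, uniq xs -> (forall y, y \in xs -> `|y| = 1 /\
      \sum_(n <- S) c n * mon (fun k => z k * y ^ v k) n = 0) ->
    (size xs <= B)%N.
Proof.
move=> uS n0S cn0; have [v vP] := separating_direction S n0.
exists v; pose dot n : int := \sum_k v k * n k.
(* multiplying by y^M makes all the exponents nonnegative *)
pose M := (\sum_(n <- S) absz (dot n))%N.
pose e n := absz (dot n + M%:Z).
have eE n : n \in S -> (e n)%:Z = dot n + M%:Z.
  move=> nS; rewrite /e gez0_abs // -lerBlDr sub0r.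
  have : (absz (dot n) <= M)%N by rewrite /M (bigD1_seq n) //= leq_addr.
  by lia.
exists (\sum_(n <- S) (e n).+1)%N => z tz xs uxs xsP.
pose Q := \sum_(n <- S) (c n * mon z n) *: 'X^(e n).
have Q0 : Q != 0.
  apply/negP => /eqP/polyP/(_ (e n0)); rewrite coef0 coef_sum (bigD1_seq n0) //=.
  rewrite big_seq_cond big1 ?addr0 => [|n /andP[nS nn0]].
    rewrite coefZ coefXn eqxx mulr1 => /eqP; rewrite mulf_eq0 (negbTE cn0) /=.
    by rewrite -normr_eq0 norm_mon // oner_eq0.
  rewrite coefZ coefXn (_ : _ == _ = false) ?mulr0 //; apply/negbTE.
  have := vP n nS nn0; apply: contraNneq => ee.
  by have := eE n nS; rewrite -ee eE // => /addIr E; exact/eqP/esym.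
apply: leq_trans (ltnW (max_poly_roots Q0 _ uxs)) _.
  apply/allP => y /xsP[x1 xr]; rewrite /root horner_sum.
  have x0 : y != 0 by rewrite -normr_eq0 x1 oner_eq0.
  rewrite (_ : \sum_(n <- S) _ = y ^ M%:Z * \sum_(n <- S) c n * mon (fun k => z k * y ^ v k) n).
    by rewrite xr mulr0.
  rewrite mulr_sumr big_seq [RHS]big_seq; apply: eq_bigr => n nS.
  rewrite hornerZ hornerXn monM mon_power // -[y ^+ e n]/(y ^ (e n)%:Z) eE // expfzDr // -/(dot n).
  by ring.
apply/leq_sizeP => j jB; rewrite coef_sum big_seq big1 // => n nS.
rewrite coefZ coefXn (_ : _ == _ = false) ?mulr0 //; apply/negbTE.
rewrite neq_ltn orbC; apply/orP; left; apply: leq_trans jB.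
by rewrite (bigD1_seq n) //= leq_addr.
Qed.

End Trig.

Arguments trigpoly_cst {R m} c.
Arguments rtrig_cst {R m} c.

(** * Integrals of functions of a random point of the torus *)

Section BoundedIntegral.
Context d (T : measurableType d) (R : realType) (mu : {measure set T -> \bar R}).
Variables (D : set T) (mD : measurable D) (Dfin : (mu D < +oo)%E).
Implicit Types f g : T -> R.

Lemma bounded_integrable f M : measurable_fun D f ->
  (forall x, D x -> `|f x| <= M) -> mu.-integrable D (EFin \o f).
Proof.
move=> mf fM; apply: measurable_bounded_integrable => //.
exists M; split; first exact: num_real.
by move=> N MN x Dx /=; rewrite (le_trans (fM x Dx)) // ltW.
Qed.

Lemma Rintegral_sum (I : Type) (r : seq I) (q : I -> T -> R) :
  (forall i, mu.-integrable D (EFin \o q i)) ->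
  \int[mu]_(t in D) (\sum_(i <- r) q i t) = \sum_(i <- r) \int[mu]_(t in D) q i t.
Proof.
move=> iq; elim: r => [|i r IH].
  by under eq_Rintegral do rewrite big_nil; rewrite Rintegral_cst // mul0r big_nil.
under eq_Rintegral do rewrite big_cons.
rewrite RintegralD // ?IH ?big_cons //.
rewrite (_ : _ \o _ = fun t => (\sum_(j <- r) (q j t)%:E)%E); last first.
  by apply/funext => t; rewrite /= sumEFin.
by apply: (integrable_sum mD) => k _; exact: iq.
Qed.

End BoundedIntegral.

Section TorusPoint.
Context d (T : measurableType d) (R : realType) (m : nat).
Local Notation C := R[i].
Local Notation re := (@complex.Re R).
Local Notation im := (@complex.Im R).
Variable V : T -> 'I_m -> C.

(** Measurability by real and imaginary parts, for targets in R[i] without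
    any reference to its Borel sets. *)
Definition cmeas (h : T -> C) : Prop :=
  measurable_fun setT (re \o h) /\ measurable_fun setT (im \o h).

Definition torus_map : Prop :=
  (forall t, torus (V t)) /\ forall k, cmeas (fun t => V t k).

Lemma cmeas_cst c : cmeas (fun=> c).
Proof. by split; exact: measurable_cst. Qed.

Lemma cmeasD h h' : cmeas h -> cmeas h' -> cmeas (fun t => h t + h' t).
Proof.
move=> [hr hi] [hr' hi']; split.
  rewrite (_ : _ \o _ = (re \o h) \+ (re \o h')); first exact: measurable_funD.
  by apply/funext => t /=; rewrite raddfD.
rewrite (_ : _ \o _ = (im \o h) \+ (im \o h')); first exact: measurable_funD.
by apply/funext => t /=; rewrite raddfD.
Qed.

Lemma cmeasM h h' : cmeas h -> cmeas h' -> cmeas (fun t => h t * h' t).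
Proof.
move=> [hr hi] [hr' hi']; split.
  rewrite (_ : _ \o _ = ((re \o h) \* (re \o h')) \-
    ((im \o h) \* (im \o h'))).
    by apply: measurable_funB; exact: measurable_funM.
  by apply/funext => t /=; case: (h t) (h' t) => ? ? [? ?].
rewrite (_ : _ \o _ = ((re \o h) \* (im \o h')) \+
    ((im \o h) \* (re \o h'))).
  by apply: measurable_funD; exact: measurable_funM.
by apply/funext => t /=; case: (h t) (h' t) => ? ? [? ?].
Qed.

Lemma cmeas_conj h : cmeas h -> cmeas (fun t => (h t)^*%C).
Proof.
move=> [hr hi]; split.
  rewrite (_ : _ \o _ = re \o h) //.
  by apply/funext => t /=; case: (h t).
rewrite (_ : _ \o _ = \- (im \o h)); first exact: measurable_funN.
by apply/funext => t /=; case: (h t).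
Qed.

Lemma cmeas_sum (I : Type) (r : seq I) (h : I -> T -> C) :
  (forall i, cmeas (h i)) -> cmeas (fun t => \sum_(i <- r) h i t).
Proof.
move=> hm; elim: r => [|i r IH].
  by under eq_fun do rewrite big_nil; exact: cmeas_cst.
by under eq_fun do rewrite big_cons; exact: cmeasD.
Qed.

Lemma cmeas_prod (I : Type) (r : seq I) (h : I -> T -> C) :
  (forall i, cmeas (h i)) -> cmeas (fun t => \prod_(i <- r) h i t).
Proof.
move=> hm; elim: r => [|i r IH].
  by under eq_fun do rewrite big_nil; exact: cmeas_cst.
by under eq_fun do rewrite big_cons; exact: cmeasM.
Qed.

Lemma cmeasX h k : cmeas h -> cmeas (fun t => h t ^+ k).
Proof.
move=> hm; elim: k => [|k IH]; first by under eq_fun do rewrite expr0; exact: cmeas_cst.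
by under eq_fun do rewrite exprS; exact: cmeasM.
Qed.

Lemma cmeas_exprz h (e : int) : (forall t, `|h t| = 1) -> cmeas h ->
  cmeas (fun t => h t ^ e).
Proof.
move=> h1 hm; case: e => k; first exact: cmeasX.
rewrite (_ : (fun t => _) = (fun t => (h t ^+ k.+1)^*%C)).
  exact/cmeas_conj/cmeasX.
apply/funext => t; rewrite NegzE -exprnN -conjc_unit //.
by rewrite normrX h1 expr1n.
Qed.

Hypothesis hV : torus_map.

Lemma cmeas_mon n : cmeas (fun t => mon (V t) n).
Proof.
by apply: cmeas_prod => k; apply: cmeas_exprz (hV.2 k) => t; exact: hV.1.
Qed.

Lemma measurable_rtrig p : rtrig p -> measurable_fun setT (p \o V).
Proof.
move=> [s ps].
have [+ _] : cmeas (fun t => trigsum s (V t)).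
  by apply: cmeas_sum => a; apply: cmeasM; [exact: cmeas_cst | exact: cmeas_mon].
congr (measurable_fun _ _); apply/funext => t /=.
by rewrite -ps //; exact: hV.1.
Qed.

Section Mu.
Variable mu : {measure set T -> \bar R}.
Variables (D : set T) (mD : measurable D) (Dfin : (mu D < +oo)%E).

Lemma integrable_rtrig p : rtrig p -> mu.-integrable D (EFin \o (p \o V)).
Proof.
move=> pt; have [M _ pM] := rtrig_bounded pt.
apply: (@bounded_integrable _ _ _ _ _ _ _ _ M) => //.
  exact: measurable_funTS (measurable_rtrig pt).
by move=> t _; apply: pM; exact: hV.1.
Qed.

Lemma Rintegral_rtrig_sum (I : Type) (r : seq I) (q : I -> ('I_m -> C) -> R) :
  (forall i, rtrig (q i)) ->
  \int[mu]_(t in D) (\sum_(i <- r) q i (V t)) = \sum_(i <- r) \int[mu]_(t in D) q i (V t).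
Proof.
by move=> qt; apply: (Rintegral_sum mD) => i; exact: integrable_rtrig.
Qed.

Variables (I : eqType) (r : seq I) (p : I -> ('I_m -> C) -> R).
Hypotheses (pt : forall i, rtrig (p i)) (p1 : forall i z, torus z -> `|p i z| <= 1).

Definition positive_all (z : 'I_m -> C) : R := (all (fun i => 0 < p i z) r)%:R.

(** A trigonometric polynomial when the p i are, close to positive_all
    away from the zero sets of the p i. *)
Definition smooth_positive_all (k : nat) (z : 'I_m -> C) : R :=
  \prod_(i <- r) ((1 + sgn_approx k (p i z)) / 2).

Lemma positive_allE z : positive_all z = \prod_(i <- r) (0 < p i z)%R%:R.
Proof.
rewrite /positive_all; elim: r => [|i r' IH]; first by rewrite big_nil.
by rewrite big_cons /= -IH; case: (0 < _) => /=; rewrite ?mul1r ?mul0r.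
Qed.

Lemma rtrig_sgn_approx k q : rtrig q -> rtrig (fun z : 'I_m -> C => sgn_approx k (q z)).
Proof.
move=> qt; elim: k => [//|k IH] /=.
apply: eq_trigpoly (rtrigM (rtrigD (rtrigM (rtrig_cst 3) IH) (rtrigN (rtrigX 3 IH)))
  (rtrig_cst (m := m) 2^-1)) => z _.
by [].
Qed.

Lemma rtrig_smooth k : rtrig (smooth_positive_all k).
Proof.
apply: rtrig_prod => i; apply: rtrigM (rtrig_cst _); apply: rtrigD (rtrig_cst _) _.
exact: rtrig_sgn_approx.
Qed.

Lemma rtrig_defect k i : rtrig (fun z => (1 - p i z ^+ 2) ^+ k).
Proof. exact/rtrigX/(rtrigD (rtrig_cst _))/rtrigN/rtrigX. Qed.

Lemma measurable_positive_all : measurable_fun setT (positive_all \o V).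
Proof.
rewrite (_ : _ \o _ = fun t => \prod_(i <- r) (0 < p i (V t))%R%:R); last first.
  by apply/funext => t; exact: positive_allE.
apply: measurable_prod => i _.
rewrite (_ : (fun t => _) = fun t => if 0 < p i (V t) then 1 else 0); last first.
  by apply/funext => t; case: ifP.
apply: measurable_fun_ifT => //.
by apply: measurable_fun_ltr => //; exact: measurable_rtrig.
Qed.

Lemma integrable_positive_all : mu.-integrable D (EFin \o (positive_all \o V)).
Proof.
apply: (@bounded_integrable _ _ _ _ _ _ _ _ 1) => //.
  exact: measurable_funTS measurable_positive_all.
by move=> t _ /=; rewrite /positive_all; case: all; rewrite ?normr1 ?normr0.
Qed.

Lemma smooth_positive_all_close k z : torus z ->
  `|positive_all z - smooth_positive_all k z| <= \sum_(i <- r) (1 - p i z ^+ 2) ^+ (2 ^ k).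
Proof.
move=> tz; rewrite positive_allE; apply: le_trans (prod_diff_le _ _ _) _.
- by move=> i; case: (0 < _); rewrite ?normr1 ?normr0.
- move=> i; have /andP[w0 w1] := step_approx_unit k (p1 i tz).
  by rewrite ger0_norm.
by apply: ler_sum => i _; apply: step_approx; exact: p1.
Qed.

Lemma integral_positive_all_close k :
  `|\int[mu]_(t in D) positive_all (V t) -
    \int[mu]_(t in D) smooth_positive_all k (V t)| <=
  \sum_(i <- r) \int[mu]_(t in D) (1 - p i (V t) ^+ 2) ^+ (2 ^ k).
Proof.
have ipa := integrable_positive_all.
have isp := integrable_rtrig (rtrig_smooth k).
have sumt : rtrig (fun z => \sum_(i <- r) (1 - p i z ^+ 2) ^+ (2 ^ k)).
  apply: eq_trigpoly (trigpoly_sum r (fun i => rtrig_defect (2 ^ k) i)) => z _.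
  by rewrite rmorph_sum.
rewrite -RintegralB //.
have ids : mu.-integrable D (EFin \o (fun t => positive_all (V t) - smooth_positive_all k (V t))).
  by apply: eq_integrable (integrableB mD ipa isp) => // t _ /=; rewrite EFinB.
apply: le_trans (le_normr_Rintegral _ _) _ => //.
apply: (@le_trans _ _ (\int[mu]_(t in D) \sum_(i <- r) (1 - p i (V t) ^+ 2) ^+ (2 ^ k))).
  apply: le_Rintegral => //.
  - apply: eq_integrable (integrable_abse ids) => //.
  - exact: (integrable_rtrig sumt).
  - by move=> t _; exact: smooth_positive_all_close (hV.1 t).
by rewrite (Rintegral_rtrig_sum r (rtrig_defect (2 ^ k))).
Qed.
End Mu.
End TorusPoint.

(** * Equidistribution and zero sets *)

Section Characters.
Context (R : realType) (m : nat).
Local Notation C := R[i].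
Local Notation freq := {ffun 'I_m -> int}.

Definition rtrig_expansion (s : seq (C * freq)) (p : ('I_m -> C) -> R) : Prop :=
  forall z, torus z -> p z = \sum_(a <- s) complex.Re (a.1 * mon z a.2).

(** Several entries of s may have frequency 0. *)
Definition constant_term (s : seq (C * freq)) : R :=
  \sum_(a <- s) (if a.2 == 0 then complex.Re a.1 else 0).

Lemma rtrig_expand p : rtrig p -> exists s, rtrig_expansion s p.
Proof.
move=> [s ps]; exists s => z tz.
by rewrite -[LHS]/(complex.Re (p z)%:C) ps // /trigsum raddf_sum.
Qed.

Lemma rtrig_character c n : rtrig (fun z : 'I_m -> C => complex.Re (c * mon z n)).
Proof. exact/rtrig_Re/(trigpolyM (trigpoly_cst c))/trigpoly_mon. Qed.

End Characters.

Section Equidistributed.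
Context d (T : measurableType d) (R : realType) (m : nat) (P : probability T R).
Local Notation C := R[i].
Local Notation freq := {ffun 'I_m -> int}.
Variable V : T -> 'I_m -> C.

(** The law of V has the Fourier coefficients of the Haar measure of the torus;
    this is the only form in which uniformity and independence are used to
    compute expectations. *)
Definition centered_characters : Prop := forall c (n : freq), n != 0 ->
  \int[P]_t complex.Re (c * mon (V t) n) = 0.

Hypotheses (hV : torus_map V) (cV : centered_characters).

Let PT : (P setT < +oo)%E. Proof. by rewrite probability_setT ltry. Qed.

Lemma expectation_rtrig p s : rtrig_expansion s p ->
  \int[P]_t p (V t) = constant_term s.
Proof.
move=> ps.
transitivity (\int[P]_t (\sum_(a <- s) complex.Re (a.1 * mon (V t) a.2))).
  by apply: eq_Rintegral => t _; exact/ps/hV.1.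
rewrite (Rintegral_rtrig_sum hV measurableT PT s (fun a => rtrig_character a.1 a.2)).
apply: eq_bigr => a _; case: eqP => [->|/eqP a0]; last exact: cV.
under eq_Rintegral do rewrite mon0 mulr1.
by rewrite Rintegral_cst // [X in fine X](probability_setT P) mulr1.
Qed.

(** Rotation multiplies the coefficient at n by x^n, which is 1 for n = 0. *)
Lemma expectation_rotate p x : torus x -> rtrig p ->
  \int[P]_t p (fun k => V t k * x k) = \int[P]_t p (V t).
Proof.
move=> tx /rtrig_expand[s ps]; rewrite (expectation_rtrig ps).
pose q (z : 'I_m -> C) := p (fun k => z k * x k).
rewrite -[LHS]/(\int[P]_t q (V t)).
rewrite (@expectation_rtrig q [seq (a.1 * mon x a.2, a.2) | a <- s]).
  rewrite /constant_term big_map; apply: eq_bigr => a _ /=.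
  by case: eqP => // ->; rewrite mon0 mulr1.
move=> z tz; rewrite big_map /q ps; last exact: torusM.
by apply: eq_bigr => a _ /=; rewrite monM mulrA mulrAC.
Qed.

Lemma torus_map_rotate x : torus x -> torus_map (fun t k => V t k * x k).
Proof.
move=> tx; split=> [t|k]; first exact: torusM (hV.1 t) tx.
by apply: cmeasM (hV.2 k) _; exact: cmeas_cst.
Qed.

End Equidistributed.

Section ZeroSet.
Context d (T : measurableType d) (R : realType) (m : nat) (P : probability T R).
Local Notation C := R[i].
Implicit Types V : T -> 'I_m -> C.

Let PT : (P setT < +oo)%E. Proof. by rewrite probability_setT ltry. Qed.

Lemma measurable_zero_set V p : torus_map V -> rtrig p ->
  measurable [set t | p (V t) = 0].
Proof.
move=> hV pt; have := measurable_rtrig hV pt measurableT (measurable_set1 0).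
by rewrite setTI; congr measurable.
Qed.

(** By dominated convergence, (1 - p^2)^k being bounded by 1 and tending to the
    indicator of p = 0. It expresses P (p = 0) by means of trigonometric polynomials. *)
Lemma zero_set_limit V p : torus_map V -> rtrig p ->
  (forall z, torus z -> `|p z| <= 1) ->
  \int[P]_t (1 - p (V t) ^+ 2) ^+ k @[k --> \oo] -->
  fine (P [set t | p (V t) = 0]).
Proof.
move=> hV pt p1; have mZ := measurable_zero_set hV pt.
have := @dominated_convergence _ _ _ P _ measurableT
  (fun k t => ((1 - p (V t) ^+ 2) ^+ k)%:E)
  (fun t => (\1_[set t | p (V t) = 0] t)%:E) (cst 1%E).
case.
- move=> k; apply/measurable_EFinP.
  by apply: (measurable_rtrig hV (p := fun z => (1 - p z ^+ 2) ^+ k));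
    exact/rtrigX/(rtrigD (rtrig_cst _))/rtrigN/rtrigX.
- by apply/measurable_EFinP; exact: measurable_indic.
- apply: aeW => t _; apply: cvg_EFin; first by near=> k.
  rewrite indicE; have := p1 _ (hV.1 t).
  case: (pselect (p (V t) = 0)) => [p0|p0] pb.
    rewrite mem_set //=; under eq_cvg do rewrite /= p0 expr0n subr0 expr1n.
    exact: cvg_cst.
  rewrite memNset //=; apply: cvg_expr.
  have p2 : 0 < p (V t) ^+ 2 by rewrite lt_neqAle sqr_ge0 eq_sym sqrf_eq0 andbT; apply/eqP.
  have p2' : p (V t) ^+ 2 <= 1.
    by rewrite -[leRHS](expr1n _ 2) -(real_normK (num_real (p _))) ler_sqr ?nnegrE.
  by rewrite ger0_norm; lra.
- by apply: (finite_measure_integrable_cst P).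
- apply: aeW => t k _ /=; rewrite lee_fin normrX.
  have p2' : p (V t) ^+ 2 <= 1.
    by rewrite -[leRHS](expr1n _ 2) -(real_normK (num_real (p _)))
       ler_sqr ?nnegrE // p1 //; exact: hV.1.
  by rewrite exprn_ile1 // ger0_norm ?subr_ge0 // gerBl sqr_ge0.
move=> _ _; rewrite integral_indic // setIT => h.
apply: fine_cvg; rewrite fineK //.
by rewrite fin_num_measure.
Unshelve. all: by end_near. Qed.

Lemma zero_set_rotate V p x : torus_map V -> centered_characters P V -> torus x ->
  rtrig p -> (forall z, torus z -> `|p z| <= 1) ->
  P [set t | p (fun k => V t k * x k) = 0] = P [set t | p (V t) = 0].
Proof.
move=> hV cV tx pt p1; have hVx := torus_map_rotate hV tx.
have fP A : measurable A -> (P A) \is a fin_num by move=> mA; rewrite fin_num_measure.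
rewrite -[LHS]fineK ?fP //; last exact: (measurable_zero_set hVx pt).
rewrite -[RHS]fineK ?fP //; last exact: (measurable_zero_set hV pt).
congr EFin; have L := zero_set_limit hV pt p1.
have Lx := zero_set_limit hVx pt p1.
rewrite -(cvg_lim _ L) // -(cvg_lim _ Lx) //; congr (lim (_ @ \oo)).
apply/funext => k.
apply: (expectation_rotate hV cV tx (p := fun z => (1 - p z ^+ 2) ^+ k)).
exact/rtrigX/(rtrigD (rtrig_cst _))/rtrigN/rtrigX.
Qed.

End ZeroSet.

Section ZeroSet.
Context d (T : measurableType d) (R : realType) (m : nat) (P : probability T R).
Local Notation C := R[i].

(** Any infinite family of distinct points of the circle would do. *)
Definition circle_point (l : nat) : C := expi (l.+1%:R^-1).

Lemma circle_point_inj : injective circle_point.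
Proof.
have in0pi l : (l.+1%:R^-1 : R) \in `[0, pi].
  rewrite in_itv /= invr_ge0 ler0n /=; apply: (@le_trans _ _ 1).
    by rewrite invf_le1 ?ltr0n // ler1n.
  have := pihalf_ge1 R; have := pi_ge0 R; lra.
move=> k l [/(cos_inj (in0pi k) (in0pi l)) + _].
by move/invr_inj/eqP; rewrite eqr_nat => /eqP[].
Qed.

Variable V : T -> 'I_m -> C.
Hypotheses (hV : torus_map V) (cV : centered_characters P V).

(** The alternative cannot be avoided, P (p = 0) being 1 for p = 0. Otherwise
    the K events p (V x_l^v) = 0 have the same probability as p (V) = 0, and at most B
    of them occur at a time, so that K P (p (V) = 0) <= B. *)
Lemma zero_set_null p : rtrig p -> (forall z, torus z -> `|p z| <= 1) ->
  (forall z, torus z -> p z = 0) \/ P [set t | p (V t) = 0] = 0%E.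
Proof.
move=> pt p1; have [S [c [uS cS pS]]] := trigpoly_collect pt.
case: S => [|n0 S] in uS cS pS *.
  left=> z tz; have := pS z tz; rewrite big_nil => /eqP.
  by rewrite eq_complex /= => /andP[/eqP].
right; have [v [B vB]] := trig_root_bound uS (mem_head _ _) (cS _ (mem_head _ _)).
pose x l k : C := circle_point l ^ v k.
have tx l : torus (x l) by move=> k; rewrite norm_exprz // norm_expi.
pose A l := [set t | p (fun k => V t k * x l k) = 0].
have mA l : measurable (A l).
  exact: (measurable_zero_set (torus_map_rotate hV (tx l)) pt).
have PA l : P (A l) = P [set t | p (V t) = 0] by exact: zero_set_rotate.
set q := P _ in PA *.
have fq : q \is a fin_num by apply: fin_num_measure; exact: measurable_zero_set.
suff KB K : K%:R * fine q <= B%:R.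
  rewrite -(fineK fq); congr EFin; apply/eqP; rewrite eq_le fine_ge0 ?measure_ge0 // andbT.
  rewrite leNgt; apply/negP => q0.
  have := archi_boundP (divr_ge0 (ler0n R B) (ltW q0)).
  by rewrite ltr_pdivrMr // ltNge KB.
have sumA t : \sum_(0 <= l < K) (\1_(A l) t) <= B%:R :> R.
  pose r := [seq l <- iota 0 K | p (fun k => V t k * x l k) == 0].
  have -> : \sum_(0 <= l < K) (\1_(A l) t) = (size r)%:R :> R.
    rewrite /r size_filter -sum1_count [in RHS]big_mkcond natr_sum /index_iota subn0.
    apply: eq_bigr => l _; rewrite indicE; case: eqP => pl.
      by rewrite mem_set.
    by rewrite memNset.
  rewrite ler_nat -(size_map circle_point).
  apply: (vB (V t) (hV.1 t)).
    by rewrite map_inj_uniq ?filter_uniq ?iota_uniq //; exact: circle_point_inj.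
  move=> _ /mapP[l + ->]; rewrite mem_filter => /andP[/eqP pl _].
  split; first exact: norm_expi.
  under eq_bigr do rewrite -/(x l).
  rewrite -[LHS](pS (fun k => V t k * x l k)) ?pl //.
  exact: torusM (hV.1 t) (tx l).
rewrite -lee_fin EFinM fineK //.
have -> : (K%:R%:E * q = \int[P]_t (\sum_(0 <= l < K) (\1_(A l) t)%:E))%E.
  rewrite ge0_integral_sum //.
  - transitivity (\sum_(0 <= l < K) q)%E.
      by rewrite -(fineK fq) sumEFin sumr_const_nat subn0 -EFinM mulr_natl.
    apply: eq_bigr => l _; rewrite integral_indic // setIT; exact/esym/PA.
  - by move=> l; apply/measurable_EFinP/measurable_indic.
have -> : (B%:R%:E = \int[P]_t (cst B%:R%:E t))%E.
  by rewrite integral_cst // [X in (_ * X)%E](probability_setT P) mule1.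
apply: ge0_le_integral => //.
- by move=> t _; rewrite sume_ge0 // => l _; rewrite lee_fin.
- by apply: emeasurable_sum => l; apply/measurable_EFinP/measurable_indic.
- by move=> t _; rewrite sumEFin lee_fin.
Qed.

End ZeroSet.

(** * Time averages of indicator functions *)

Lemma cvg_sumr (R : realType) (A I : Type) (F : set_system A) (FF : Filter F)
    (r : seq I) (Q : pred I) (g : I -> A -> R) (l : I -> R) :
  (forall i, Q i -> g i x @[x --> F] --> l i) ->
  \sum_(i <- r | Q i) g i x @[x --> F] --> \sum_(i <- r | Q i) l i.
Proof.
move=> gl; elim: r => [|i r IH].
  by under eq_cvg do rewrite big_nil; rewrite big_nil; exact: cvg_cst.
under eq_cvg do rewrite big_cons; rewrite big_cons.
by case: ifP => // /gl gi; exact: cvgD.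
Qed.

Section Limit.
Context d (T : measurableType d) (R : realType) (m : nat) (P : probability T R).
Local Notation C := R[i].
Local Notation mu := (@lebesgue_measure R).
Variable V : T -> 'I_m -> C.
Hypotheses (hV : torus_map V) (cV : centered_characters P V).
Variable U : measurableTypeR R -> 'I_m -> C.

Definition time_average (g : R -> R) (X : R) : R := X^-1 * \int[mu]_(y in `[0, X]) g y.

Hypothesis hU : torus_map U.
Hypothesis cU : forall (c : C) (n : {ffun 'I_m -> int}), n != 0 ->
  time_average (fun y => complex.Re (c * mon (U y) n)) X @[X --> +oo] --> (0 : R).

Let mI (X : R) : measurable (`[0, X]%classic : set R). Proof. exact: measurable_itv. Qed.

Let fI (X : R) : (mu (`[0, X]%classic : set R)%R < +oo)%E.
Proof. by rewrite lebesgue_measure_itv /=; case: ifP => _; rewrite ?ltry //. Qed.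

Let PT : (P setT < +oo)%E. Proof. by rewrite probability_setT ltry. Qed.

Lemma time_average_cst (c : R) (X : R) : 0 < X -> time_average (fun=> c) X = c.
Proof.
move=> X0; rewrite /time_average Rintegral_cst //.
rewrite [Z in fine Z](_ : _ = X%:E) /=; first by rewrite mulrCA mulVf ?mulr1 // gt_eqF.
by rewrite lebesgue_measure_itv /= lte_fin X0 sube0.
Qed.

(** Both sides are linear in p, and agree with the constant term of p on characters. *)
Lemma time_average_rtrig p : rtrig p ->
  time_average (p \o U) X @[X --> +oo] --> \int[P]_t p (V t).
Proof.
move=> /rtrig_expand[s ps]; rewrite (expectation_rtrig hV cV ps).
have E X : time_average (p \o U) X =
    \sum_(a <- s) time_average (fun y => complex.Re (a.1 * mon (U y) a.2)) X.
  rewrite /time_average -mulr_sumr; congr (_ * _).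
  rewrite -(Rintegral_rtrig_sum hU (mI X) (fI X) s (fun a => rtrig_character a.1 a.2)).
  by apply: eq_Rintegral => y _; exact/ps/hU.1.
under eq_cvg do rewrite E.
apply: cvg_sumr => a _; case: eqP => [a0|/eqP]; last exact: cU.
apply: cvg_near_cst; near=> X.
rewrite -[RHS](@time_average_cst _ X) // a0.
by congr (_ * _); apply: eq_Rintegral => y _; rewrite mon0 mulr1.
Unshelve. all: by end_near. Qed.

Section Unit.
Variables (I : eqType) (r : seq I) (p : I -> ('I_m -> C) -> R).
Hypotheses (pt : forall i, rtrig (p i)) (p1 : forall i z, torus z -> `|p i z| <= 1).

(** Up to the means of the (1 - p_i^2)^(2^k), positive_all may be replaced on both
    sides by its smooth version. These means are small at V for k large, and
    then small along U for X large, as they converge to the means at V. *)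
Lemma time_average_positive_unit :
  time_average (positive_all r p \o U) X @[X --> +oo] -->
  \int[P]_t positive_all r p (V t).
Proof.
(* if some p i is identically 0, both sides vanish *)
have [/hasP[i ir zi]|nz] := boolP (has (fun i => `[< forall z, torus z -> p i z = 0 >]) r).
  have pa0 z : torus z -> positive_all r p z = 0.
    move=> tz; rewrite /positive_all; case: allP => // /(_ _ ir).
    by move/asboolP: zi => /(_ z tz) ->; rewrite ltxx.
  rewrite (_ : \int[P]_t _ = 0); last first.
    by under eq_Rintegral do rewrite (pa0 _ (hV.1 _)); rewrite Rintegral_cst // mul0r.
  rewrite (_ : (fun X => _) = fun=> 0); first exact: cvg_cst.
  apply/funext => X; rewrite /time_average.
  by under eq_Rintegral do rewrite /= (pa0 _ (hU.1 _)); rewrite Rintegral_cst // mul0r mulr0.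
have null i : i \in r -> P [set t | p i (V t) = 0] = 0%E.
  move=> ir; case: (zero_set_null hV cV (pt i) (p1 i)) => // zi.
  by case/negP: nz; apply/hasP; exists i => //; apply/asboolP.
pose err k := \sum_(i <- r) \int[P]_t (1 - p i (V t) ^+ 2) ^+ (2 ^ k).
have err0 : err k @[k --> \oo] --> (0 : R).
  have -> : (0 : R) = \sum_(i <- r | i \in r) 0 by rewrite big1.
  have L i : i \in r -> \int[P]_t (1 - p i (V t) ^+ 2) ^+ k @[k --> \oo] --> (0 : R).
    by move=> ir; have := zero_set_limit hV (pt i) (p1 i) (P := P); rewrite null.
  rewrite /err; under eq_cvg do rewrite big_seq.
  apply: cvg_sumr => i ir.
  apply: cvg_comp (L i ir).
  apply/cvgnyPge => A; near=> k; apply: leq_trans (ltnW (ltn_expl k _)) => //.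
  by near: k; exact: nbhs_infty_ge.
apply/cvgrPdist_lt => e e0.
have e4 : 0 < e / 4 by rewrite divr_gt0.
have /cvgrPdist_lt/(_ _ e4) [k _ /(_ k (leqnn k))] := err0.
rewrite sub0r normrN => /(le_lt_trans (ler_norm _)) ek.
have smoothL := time_average_rtrig (rtrig_smooth r pt k).
have errL : (\sum_(i <- r) time_average (fun y => (1 - p i (U y) ^+ 2) ^+ (2 ^ k)) X)
    @[X --> +oo] --> err k.
  by apply: cvg_sumr => i _; exact: time_average_rtrig (rtrig_defect pt (2 ^ k) i).
have e2 : 0 < e / 2 by rewrite divr_gt0.
near=> X.
have X0 : 0 < X by [].
have d1 := integral_positive_all_close hV measurableT PT r pt p1 k.
have d2 : `|time_average (positive_all r p \o U) X -
    time_average (smooth_positive_all r p k \o U) X| <=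
    \sum_(i <- r) time_average (fun y => (1 - p i (U y) ^+ 2) ^+ (2 ^ k)) X.
  rewrite /time_average -mulrBr normrM (ger0_norm (ltW _)) ?invr_gt0 //.
  rewrite -mulr_sumr ler_wpM2l ?invr_ge0 ?(ltW X0) //.
  exact: (integral_positive_all_close hU (mI X) (fI X) r pt p1 k).
have d3 : `|\int[P]_t smooth_positive_all r p k (V t) -
    time_average (smooth_positive_all r p k \o U) X| < e / 4.
  by near: X; move/cvgrPdist_lt: smoothL; apply.
have d4 : `|err k -
    \sum_(i <- r) time_average (fun y => (1 - p i (U y) ^+ 2) ^+ (2 ^ k)) X| < e / 4.
  by near: X; move/cvgrPdist_lt: errL; apply.
rewrite -/(err k) in d1.
move: d1 d2 d3 d4 ek.
set a := \int[P]_t positive_all r p (V t); set b := \int[P]_t _.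
set a' := time_average _ _; set b' := time_average _ _; set E := \sum_(i <- r) _.
rewrite !(ler_norml, ltr_norml) => /andP[? ?] /andP[? ?] /andP[? ?] /andP[? ?] ?.
by apply/andP; split; lra.
Unshelve. all: by end_near. Qed.
End Unit.

Variables (I : eqType) (r : seq I) (p : I -> ('I_m -> C) -> R).
Hypothesis pt : forall i, rtrig (p i).

(** Dividing each p i by a bound does not change its sign. *)
Lemma time_average_positive :
  time_average (positive_all r p \o U) X @[X --> +oo] -->
  \int[P]_t positive_all r p (V t).
Proof.
have bounded i : exists M, 0 < M /\ forall z, torus z -> `|p i z| <= M.
  by have [M M0 pM] := rtrig_bounded (pt i); exists M.
have [M MP] := boolp.choice bounded.
pose q i z := p i z * (M i)^-1.
have E z : positive_all r p z = positive_all r q z.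
  rewrite /positive_all; congr (_ %:R); apply: congr1; apply: eq_all => i.
  by rewrite /q pmulr_lgt0 // invr_gt0; case: (MP i).
rewrite (_ : positive_all r p = positive_all r q); last exact/funext.
apply: time_average_positive_unit => i.
  exact: rtrigM (pt i) (rtrig_cst _).
move=> z tz; have [M0 pM] := MP i.
by rewrite /q normrM normfV (gtr0_norm M0) ler_pdivrMr // mul1r pM.
Qed.

End Limit.

(** * Time averages of characters *)

Section Sinusoid.
Variable R : realType.
Local Notation mu := (@lebesgue_measure R).

Lemma Re_mul_expi (c : R[i]) (t : R) :
  complex.Re (c * expi t) = complex.Re c * cos t - complex.Im c * sin t.
Proof. by case: c. Qed.

Let primitive (a b l y : R) : R := (a * sin (l * y) + b * cos (l * y)) / l.

Let is_derive_primitive a b l y : l != 0 ->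
  is_derive y (1 : R) (primitive a b l) (a * cos (l * y) - b * sin (l * y)).
Proof.
move=> l0.
have dl : is_derive y (1 : R) (fun y => l * y) l.
  by apply: is_derive_eq; rewrite /GRing.scale /=; ring.
have ds : is_derive y (1 : R) (sin \o (fun y => l * y)) (l * cos (l * y)).
  by apply: is_derive_eq; rewrite mulrC.
have dc : is_derive y (1 : R) (cos \o (fun y => l * y)) (l * - sin (l * y)).
  by apply: is_derive_eq; rewrite mulrC.
rewrite (_ : primitive a b l = fun y => (l^-1 * a) *: (sin \o (fun y => l * y)) y +
   (l^-1 * b) *: (cos \o (fun y => l * y)) y); last first.
  by apply/funext => z; rewrite /primitive /GRing.scale /=; ring.
apply: is_derive_eq; rewrite /GRing.scale /=.
by field.
Qed.

Lemma integral_sinusoid a b l X : l != 0 -> 0 < X ->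
  \int[mu]_(y in `[0, X]) (a * cos (l * y) - b * sin (l * y)) =
  (a * sin (l * X) + b * (cos (l * X) - 1)) / l.
Proof.
move=> l0 X0; rewrite /Rintegral (@continuous_FTC2 _ _ (primitive a b l)) //.
- by rewrite /primitive -EFinB /= mulr0 sin0 cos0; ring.
- have cs : continuous (fun y : R => sin (l * y)).
    by move=> y; apply: continuous_comp; [exact: mulrl_continuous | exact: continuous_sin].
  have cc : continuous (fun y : R => cos (l * y)).
    by move=> y; apply: continuous_comp; [exact: mulrl_continuous | exact: continuous_cos].
  apply: continuous_subspaceT => y.
  by apply: cvgB; apply: cvgM; [exact: cvg_cst | exact: cc | exact: cvg_cst | exact: cs].
- have cF y : {for y, continuous (primitive a b l)}.
    apply: differentiable_continuous; apply/derivable1_diffP.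
    by have [] := is_derive_primitive a b y l0.
  split.
  + by move=> y _; have [] := is_derive_primitive a b y l0.
  + exact/cvg_at_right_filter/cF.
  + exact/cvg_at_left_filter/cF.
- by move=> y _; rewrite derive1E; apply: derive_val; exact: is_derive_primitive.
Qed.

(** The integral over [0, X] is bounded independently of X because l <> 0. *)
Lemma average_character (c : R[i]) l : l != 0 ->
  time_average (fun y => complex.Re (c * expi (l * y))) X @[X --> +oo] --> (0 : R).
Proof.
move=> l0; case: c => a b.
have invX : (X : R)^-1 @[X --> +oo] --> (0 : R).
  by apply/(gtr0_cvgV0 (f := id)); [near=> X | exact: cvg_id].
pose K := (`|a| + `|b| * 2) / `|l|.
apply: (@squeeze_cvgr _ _ _ _ (fun X => - (K * X^-1)) (fun X => K * X^-1)).
- near=> X.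
  have X0 : 0 < X by [].
  rewrite /time_average; under eq_Rintegral do rewrite Re_mul_expi /=.
  rewrite integral_sinusoid // -ler_norml normrM (mulrC K) ger0_norm ?invr_ge0 ?(ltW X0) //.
  rewrite ler_wpM2l ?invr_ge0 ?(ltW X0) // normrM normfV ler_wpM2r ?invr_ge0 //.
  apply: le_trans (ler_normD _ _) _; rewrite !normrM lerD //.
    by rewrite ler_piMr // ler_norml sin_geN1 sin_le1.
  rewrite ler_wpM2l // ler_norml.
  by have := cos_geN1 (l * X); have := cos_le1 (l * X); lra.
- rewrite -oppr0; apply: cvgN; rewrite -(mulr0 K); apply: cvgM; first exact: cvg_cst.
  exact: invX.
- rewrite -(mulr0 K); apply: cvgM; first exact: cvg_cst.
  exact: invX.
Unshelve. all: by end_near. Qed.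

End Sinusoid.

(** * Uniform points of the circle *)

Section BorelComplex.
Variable R : realType.
Local Notation C := R[i].

Lemma normc_le_ReIm (z : C) : `|z| <= (`|complex.Re z| + `|complex.Im z|)%:C.
Proof.
rewrite normc_def lecR -[leRHS]ger0_norm ?addr_ge0 // -sqrtr_sqr ler_wsqrtr //.
rewrite -(real_normK (num_real (complex.Re z))) -(real_normK (num_real (complex.Im z))).
by rewrite sqrrD addrAC lerDl mulrn_wge0 // mulr_ge0.
Qed.

Lemma normc_ge_Im (z : C) : `|complex.Im z|%:C <= `|z|.
Proof.
case: z => a b; apply: le_trans (normc_ge_Re (b +i* a)) _.
by rewrite !normc_def /= addrC.
Qed.

(** Used for the real and imaginary parts, which are 1-Lipschitz. *)
Lemma measurable_lipschitz_borel (g : C -> R) :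
  (forall z y, `|g z - g y|%:C <= `|z - y|) ->
  measurable_fun setT (g : borelC R -> R).
Proof.
move=> gL; apply: (measurability _ (RGenOInfty.measurableE R)) => _ [_ [x ->] <-].
rewrite setTI; apply: sub_sigma_algebra; rewrite openE => z /=.
rewrite in_itv /= andbT => zx; apply/nbhs_ballP; exists (g z - x)%:C.
  by rewrite /= ltcR subr_gt0.
move=> y; rewrite -ball_normE /= => yz; rewrite /= in_itv /= andbT.
have := le_lt_trans (gL _ _) yz; rewrite ltcR => h.
by have := le_lt_trans (ler_norm _) h; lra.
Qed.

Lemma measurable_Re_borel : measurable_fun setT (complex.Re (R := R) : borelC R -> R).
Proof.
by apply: measurable_lipschitz_borel => z y; rewrite -raddfB; exact: normc_ge_Re.
Qed.

Lemma measurable_Im_borel : measurable_fun setT (complex.Im (R := R) : borelC R -> R).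
Proof.
by apply: measurable_lipschitz_borel => z y; rewrite -raddfB; exact: normc_ge_Im.
Qed.

Lemma measurable_expi_borel : measurable_fun setT (@expi R : R -> borelC R).
Proof.
apply: (@measurability _ _ _ (borelC R) setT (@expi R) (@open R[i]^o)) => // _ [G oG <-].
rewrite setTI; apply: open_measurable; rewrite openE => t /= Gt.
move: oG; rewrite openE => /(_ _ Gt) /nbhs_ballP[e /= e0 eG].
have eE : e = (complex.Re e)%:C by rewrite RRe_real // gtr0_real.
have e2 : 0 < complex.Re e / 2 by rewrite divr_gt0 // -ltcR -eE.
have hc := @continuous_cos R t; have hs := @continuous_sin R t.
move/cvgrPdist_lt : hc => /(_ _ e2) hc; move/cvgrPdist_lt : hs => /(_ _ e2) hs.
rewrite /interior; near=> y; apply: eG; rewrite -ball_normE /=.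
apply: le_lt_trans (normc_le_ReIm _) _; rewrite eE ltcR /=.
have : `|cos t - cos y| < complex.Re e / 2 by near: y.
have : `|sin t - sin y| < complex.Re e / 2 by near: y.
by lra.
Unshelve. all: by end_near. Qed.

End BorelComplex.

Section UniformCircle.
Context (R : realType) (d : measure_display) (W : measurableType d) (P : probability W R).
Local Notation C := R[i].
Variable Z : {RV P >-> borelC R}.
Hypothesis uZ : uniform_on_circle Z.

Lemma cmeas_RV : cmeas (fun w => Z w : C).
Proof.
have mZ : measurable_fun setT (Z : W -> borelC R) by exact: measurable_funP.
split.
  exact: measurableT_comp (@measurable_Re_borel R) mZ.
exact: measurableT_comp (@measurable_Im_borel R) mZ.
Qed.

Local Notation mu := (@lebesgue_measure R).

(** The integral is transported by the law of Z for the nonnegative function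
    |phi + M|, which is phi + M on the circle; the constant M is then removed
    from both sides. *)
Lemma expectation_uniform (phi : C -> R) (M : R) :
  measurable_fun setT (phi : borelC R -> R) ->
  (forall z : C, `|z| = 1 -> `|phi z| <= M) ->
  \int[P]_w phi (Z w) = (pi *+ 2)^-1 * \int[mu]_(t in `[0, pi *+ 2]) phi (expi t).
Proof.
move=> mphi phiM; pose f z : R := `|phi z + M|.
have mf : measurable_fun setT (f : borelC R -> R).
  by apply: measurableT_comp => //; exact: measurable_funD.
have fE z : `|z| = 1 -> f z = phi z + M.
  move=> z1; rewrite /f ger0_norm //.
  by have := phiM z z1; rewrite ler_norml => /andP[]; lra.
have f0 z : (0 <= (f z)%:E)%E by rewrite lee_fin /f.
have mfE : measurable_fun setT (EFin \o f : borelC R -> \bar R) by exact/measurable_EFinP.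
have mfe : measurable_fun setT (fun t : R => (f (expi t))%:E).
  exact: measurableT_comp mfE (@measurable_expi_borel R).
have expi1 t : `|expi t : C| = 1 by exact: norm_expi.
have I1 : P.-integrable setT (EFin \o (fun w => phi (Z w))).
  apply: (@bounded_integrable _ _ _ _ _ _ _ _ M) => //.
  - by rewrite [X in (X < _)%E](probability_setT P) ltry.
  - by apply: measurableT_comp mphi _; exact: measurable_funP.
  - by move=> w _; apply: phiM; exact: uZ.1.
have muI : mu (`[0, pi *+ 2]%classic : set R) = (pi *+ 2)%:E.
  by rewrite lebesgue_measure_itv /= lte_fin two_pi_gt0 sube0.
have I2 : mu.-integrable `[0, pi *+ 2] (EFin \o (fun t => phi (expi t))).
  apply: (@bounded_integrable _ _ _ _ _ _ _ _ M) => //.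
  - by rewrite [X in (X < _)%E]muI ltry.
  - apply: measurable_funTS; exact: measurableT_comp mphi (@measurable_expi_borel R).
  - by move=> t _; apply: phiM; exact: norm_expi.
have I3 : mu.-integrable `[0, pi *+ 2] (EFin \o (fun t => f (expi t))).
  apply: (@bounded_integrable _ _ _ _ _ _ _ _ (M + M)) => //.
  - by rewrite [X in (X < _)%E]muI ltry.
  - exact/measurable_funTS/measurable_EFinP.
  - move=> t _; rewrite fE // (le_trans (ler_normD _ _)) // lerD ?phiM //.
    rewrite ger0_norm //; exact: le_trans (phiM _ (expi1 t)).
have key : \int[P]_w f (Z w) = (pi *+ 2)^-1 * \int[mu]_(t in `[0, pi *+ 2]) f (expi t).
  rewrite /Rintegral.
  have -> : (\int[P]_w (f (Z w))%:E = \int[distribution P Z]_z (f z)%:E)%E.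
    by rewrite ge0_integral_distribution.
  rewrite (@eq_measure_integral _ _ _ _
    (pushforward (uniform_prob (two_pi_gt0 R)) (@expi R : _ -> borelC R))).
  - exact: (@measurable_expi_borel R).
  - move=> mexpi; rewrite ge0_integral_pushforward // preimage_setT integral_uniform //.
      by rewrite subr0 fineM //; exact: integrable_fin_num I3.
    by move=> t; exact: f0.
  - by move=> ? A mA _; exact: (uZ.2 A mA).
have : \int[P]_w f (Z w) = \int[P]_w phi (Z w) + M.
  under eq_Rintegral do rewrite (fE _ (uZ.1 _)).
  rewrite RintegralD // ?Rintegral_cst //; last exact: finite_measure_integrable_cst.
  by rewrite [X in fine X](probability_setT P) mulr1.
rewrite key; under eq_Rintegral do rewrite (fE _ (expi1 _)).
rewrite RintegralD //; last first.
  by apply: (@bounded_integrable _ _ _ _ _ _ _ _ `|M|) => //; rewrite [X in (X < _)%E]muI ltry.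
rewrite Rintegral_cst // [X in fine X]muI /= mulrDr mulrCA mulVf ?mulr1;
  last by rewrite gt_eqF // two_pi_gt0.
by move/addIr.
Qed.

Lemma expectation_uniform_power (c : C) n : (0 < n)%N ->
  \int[P]_w complex.Re (c * (Z w : C) ^+ n) = 0.
Proof.
move=> n0; pose phi (z : C) := complex.Re (c * z ^+ n).
have cid : cmeas (fun z : borelC R => z : C).
  by split; [exact: measurable_Re_borel | exact: measurable_Im_borel].
have [mphi _] := cmeasM (cmeas_cst (borelC R) c) (cmeasX n cid).
rewrite (@expectation_uniform phi (complex.Re `|c|)) //; last first.
  move=> z z1; rewrite -lecR; apply: le_trans (normc_ge_Re _) _.
  by rewrite normrM normrX z1 expr1n mulr1 RRe_real // normr_real.
rewrite /phi; under eq_Rintegral do rewrite -expiMn -mulr_natl Re_mul_expi.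
rewrite integral_sinusoid ?two_pi_gt0 //; last by rewrite pnatr_eq0 -lt0n.
have -> : n%:R * (pi *+ 2) = pi *+ 2 *+ n :> R by rewrite mulr_natl.
have : expi (pi *+ 2 *+ n) = 1 :> C.
  by rewrite expiMn /expi cos2pi sin2pi expr1n.
by case=> -> ->; rewrite subrr !mulr0 addr0 mul0r mulr0.
Qed.

Lemma expectation_uniform_exprz (c : C) (e : int) : e != 0 ->
  \int[P]_w complex.Re (c * (Z w : C) ^ e) = 0.
Proof.
case: e => n n0; first by apply: expectation_uniform_power; rewrite lt0n.
rewrite -[RHS](@expectation_uniform_power c^*%C n.+1) //.
apply: eq_Rintegral => w _; rewrite NegzE -exprnN -conjc_unit; last first.
  by rewrite normrX uZ.1 expr1n.
rewrite (_ : c * _ = (c^*%C * (Z w : C) ^+ n.+1)^*%C).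
  by case: (_ * _).
by rewrite (rmorphM (conjc (R:=R))) /= conjcK.
Qed.

End UniformCircle.

(** On the circle z |-> z^e is Lipschitz also for e < 0, inversion being an
    isometry there. *)
Lemma exprz_diff_le (K : numFieldType) (x y : K) (e : int) : `|x| = 1 -> `|y| = 1 ->
  `|x ^ e - y ^ e| <= `|x - y| *+ absz e.
Proof.
move=> x1 y1; have x0 : x != 0 by rewrite -normr_eq0 x1 oner_eq0.
have y0 : y != 0 by rewrite -normr_eq0 y1 oner_eq0.
have pos n : `|x ^+ n - y ^+ n| <= `|x - y| *+ n.
  have E (w : K) : w ^+ n = \prod_(i <- iota 0 n) w.
    by rewrite big_const_seq count_predT size_iota iter_mulr_1.
  rewrite !E.
  apply: le_trans (prod_diff_le _ _ _) _ => [_|_|]; rewrite ?x1 ?y1 //.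
  by rewrite big_const_seq count_predT size_iota iter_addr_0.
case: e => n; first exact: pos.
rewrite NegzE -!exprnN /=.
have -> : x ^- n.+1 - y ^- n.+1 = (y ^+ n.+1 - x ^+ n.+1) / (x ^+ n.+1 * y ^+ n.+1).
  by field; rewrite !expf_neq0.
by rewrite normrM normfV normrM !normrX x1 y1 !expr1n mulr1 invr1 mulr1 distrC; exact: pos.
Qed.

(** * Independence through finite-valued approximations *)

Section FiniteValued.
Context d (T : measurableType d) (R : realType) (P : probability T R).

Let PT : (P setT < +oo)%E. Proof. by rewrite probability_setT ltry. Qed.

Variables (L : finType) (Y : T -> L).
Hypothesis mY : forall l, measurable [set t | Y t = l].

(** Functions of Y are simple functions, so that their integrals are finite sums. *)
Lemma finite_valuedE (H : L -> R) t :
  H (Y t) = \sum_l H l * \1_[set t | Y t = l] t.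
Proof.
rewrite (bigD1 (Y t)) //= indicE mem_set // mulr1 big1 ?addr0 // => l lY.
by rewrite indicE memNset ?mulr0 //= => /eqP; rewrite eq_sym (negbTE lY).
Qed.

Lemma measurable_finite_valued (H : L -> R) : measurable_fun setT (H \o Y).
Proof.
rewrite (_ : _ \o _ = fun t => \sum_l H l * \1_[set t | Y t = l] t); last first.
  by apply/funext => t; exact: finite_valuedE.
apply: measurable_sum => l; apply: measurable_funM; first exact: measurable_cst.
exact: measurable_indic.
Qed.

Lemma expectation_finite_valued (H : L -> R) :
  \int[P]_t H (Y t) = \sum_l H l * fine (P [set t | Y t = l]).
Proof.
under eq_Rintegral do rewrite finite_valuedE.
rewrite Rintegral_sum //; last first.
  move=> l; apply: (@bounded_integrable _ _ _ _ _ _ _ _ `|H l|) => //.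
    by apply: measurable_funM; [exact: measurable_cst | exact: (measurable_indic (mY l))].
  by move=> t _; rewrite indicE; case: (_ \in _); rewrite ?mulr1 ?mulr0 ?normr0.
apply: eq_bigr => l _; rewrite RintegralZl //; last first.
  apply: (@bounded_integrable _ _ _ _ _ _ _ _ 1) => //.
  by move=> t _; rewrite indicE; case: (_ \in _); rewrite ?normr1 ?normr0.
by rewrite /Rintegral integral_indic // setIT.
Qed.

End FiniteValued.

Section Grid.
Variable R : realType.
Local Notation C := R[i].
Variable N : nat.
Hypothesis N0 : (0 < N)%N.

(** Otherwise some j / N - 1 would lie in the interval between x and y. *)
Lemma grid_separates (x y : R) : -1 <= x <= 1 -> -1 <= y <= 1 ->
  (forall j : 'I_(N.*2.+1), (j%:R / N%:R - 1 <= x) = (j%:R / N%:R - 1 <= y)) ->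
  `|x - y| <= N%:R^-1.
Proof.
wlog xy : x y / x <= y.
  by move=> H x1 y1 h; case: (leP x y) => [/H|/ltW/H]; [|rewrite distrC]; apply.
move=> /andP[x1 x2] /andP[y1 y2] h; rewrite distrC ger0_norm ?subr_ge0 //.
have NR : 0 < N%:R :> R by rewrite ltr0n.
(* the largest grid point below y is j / N - 1 with j the integral part of a *)
pose a := N%:R * (y + 1); have a0 : 0 <= a by rewrite mulr_ge0 //; lra.
have /andP[ja aj] := truncn_itv a0.
have jN : (Num.truncn a < N.*2.+1)%N.
  rewrite ltnS -(ler_nat R) (le_trans ja) // -mul2n natrM mulrC /a ler_wpM2l //; lra.
have := h (Ordinal jN) => /= {}h.
have jy : (Num.truncn a)%:R / N%:R - 1 <= y.
  by rewrite lerBlDr ler_pdivrMr // mulrC.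
move: h; rewrite jy => jx.
have : y + 1 <= ((Num.truncn a)%:R + 1) / N%:R.
  by rewrite ler_pdivlMr // mulrC natr1 ltW.
by rewrite mulrDl mul1r; lra.
Qed.

(** The position of z with respect to finitely many vertical and horizontal
    lines, as a vector of booleans: its fibers are visibly Borel sets. *)
Definition grid_code (z : C) : {ffun 'I_(N.*2.+1) * bool -> bool} :=
  [ffun j : 'I_(N.*2.+1) * bool =>
    (j.1 : nat)%:R / N%:R - 1 <= (if j.2 then complex.Re z else complex.Im z)].

(** Any point of the circle in the cell; cells that miss the circle get an
    arbitrary point of it. *)
Definition grid_rep (l : {ffun 'I_(N.*2.+1) * bool -> bool}) : C :=
  xget 1 [set z | `|z| = 1 /\ grid_code z = l].

Lemma norm_grid_rep l : `|grid_rep l| = 1.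
Proof. by rewrite /grid_rep; case: xgetP => [z _ []|_] //; rewrite normr1. Qed.

Lemma grid_code_rep z : `|z| = 1 -> grid_code (grid_rep (grid_code z)) = grid_code z.
Proof.
move=> z1; rewrite /grid_rep; case: xgetP => [y _ [] //|h].
by case: (h z).
Qed.

Lemma grid_rep_close z : `|z| = 1 -> `|z - grid_rep (grid_code z)| <= (2 / N%:R)%:C.
Proof.
move=> z1; set y := grid_rep _.
have y1 : `|y| = 1 by exact: norm_grid_rep.
have zy : grid_code z = grid_code y by rewrite grid_code_rep.
have bRe (x : C) : `|x| = 1 -> -1 <= complex.Re x <= 1.
  by move=> x1; rewrite -ler_norml -lecR -[leRHS]x1; exact: normc_ge_Re.
have bIm (x : C) : `|x| = 1 -> -1 <= complex.Im x <= 1.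
  by move=> x1; rewrite -ler_norml -lecR -[leRHS]x1; exact: normc_ge_Im.
apply: le_trans (normc_le_ReIm _) _; rewrite lecR !raddfB /=.
have := grid_separates (bRe _ z1) (bRe _ y1).
have := grid_separates (bIm _ z1) (bIm _ y1).
move/(_ (fun j => _)) => hI; move/(_ (fun j => _)) => hR.
have -> : 2 / N%:R = N%:R^-1 + N%:R^-1 :> R by ring.
apply: lerD.
  apply: hR => j; have /ffunP/(_ (j, true)) := zy; by rewrite !ffunE.
apply: hI => j; have /ffunP/(_ (j, false)) := zy; by rewrite !ffunE.
Qed.

Lemma measurable_grid_cell l : measurable ([set z | grid_code z = l] : set (borelC R)).
Proof.
rewrite (_ : [set _ | _] = \bigcap_(j in [set: 'I_(N.*2.+1) * bool])
  [set z : borelC R | ((j.1 : nat)%:R / N%:R - 1 <=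
    (if j.2 then complex.Re z else complex.Im z)) = l j]).
  apply: fin_bigcap_measurable => // j _.
  have mg : measurable_fun setT (fun z : borelC R => if j.2 then complex.Re z else complex.Im z).
    by case: j.2; [exact: measurable_Re_borel | exact: measurable_Im_borel].
  have := measurable_fun_ler (@measurable_cst _ _ (borelC R) R setT ((j.1 : nat)%:R / N%:R - 1)) mg.
  by move=> /(_ measurableT [set l j] I); rewrite setTI.
apply/seteqP; split => z /=.
  by move=> <- j _; rewrite ffunE.
by move=> h; apply/ffunP => j; rewrite ffunE h.
Qed.

End Grid.

Section Independent.
Context (R : realType) (d : measure_display) (W : measurableType d) (P : probability W R).
Local Notation C := R[i].
Variables (m : nat) (Z : 'I_m -> {RV P >-> borelC R}).
Hypotheses (uZ : forall k, uniform_on_circle (Z k)) (iZ : mutually_independent Z).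

Definition torus_point (w : W) (k : 'I_m) : C := Z k w.

Lemma torus_map_uniform : torus_map torus_point.
Proof. by split=> [w k|k]; [exact: (uZ k).1 | exact: cmeas_RV]. Qed.

Let PT : (P setT < +oo)%E. Proof. by rewrite probability_setT ltry. Qed.

Lemma expectation_close (f g : W -> R) (M e : R) :
  measurable_fun setT f -> measurable_fun setT g ->
  (forall w, `|f w| <= M) -> (forall w, `|f w - g w| <= e) ->
  `|\int[P]_w f w - \int[P]_w g w| <= e.
Proof.
move=> mf mg fM fge.
have If : P.-integrable setT (EFin \o f).
  by apply: (@bounded_integrable _ _ _ _ _ _ _ _ M).
have Ig : P.-integrable setT (EFin \o g).
  apply: (@bounded_integrable _ _ _ _ _ _ _ _ (M + e)) => // w _.
  rewrite (_ : g w = f w - (f w - g w)); last by ring.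
  by rewrite (le_trans (ler_normB _ _)) // lerD.
have mfg : measurable_fun setT (fun w => f w - g w) by exact: measurable_funB.
have Ifg : P.-integrable setT (EFin \o (fun w => f w - g w)).
  by apply: (@bounded_integrable _ _ _ _ _ _ _ _ e).
rewrite -RintegralB //; apply: le_trans (le_normr_Rintegral _ _) _ => //.
rewrite -[leRHS]mulr1 -[X in _ <= _ * X](_ : fine (P setT) = 1); last first.
  by rewrite [X in fine X](probability_setT P).
rewrite -Rintegral_cst //; apply: le_Rintegral => //.
- by apply: (@bounded_integrable _ _ _ _ _ _ _ _ e) => //;
    [exact: measurableT_comp | move=> w _; rewrite normr_id].
- by apply: (@bounded_integrable _ _ _ _ _ _ _ _ `|e|).
Qed.

Section Discretized.
Variable N : nat.
Hypothesis N0 : (0 < N)%N.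
Local Notation cell := {ffun 'I_(N.*2.+1) * bool -> bool}.

Let code (k : 'I_m) (w : W) : cell := grid_code N (Z k w : C).
Let codes (w : W) : {ffun 'I_m -> cell} := [ffun k => code k w].
Let prob (k : 'I_m) (a : cell) : R := fine (P [set w | code k w = a]).

Let measurable_code k a : measurable [set w | code k w = a].
Proof.
have mZ : measurable_fun setT (Z k : W -> borelC R) by exact: measurable_funP.
by have := mZ measurableT _ (measurable_grid_cell (R := R) a); rewrite setTI.
Qed.

Let codesE l : [set w | codes w = l] =
  \bigcap_(k in [set` [set: 'I_m]%SET]) Z k @^-1` [set z | grid_code N z = l k].
Proof.
apply/seteqP; split => w /=.
  by move=> <- k _ /=; rewrite ffunE.
by move=> h; apply/ffunP => k; rewrite ffunE; apply: h; rewrite /= inE.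
Qed.

Let measurable_codes l : measurable [set w | codes w = l].
Proof.
rewrite codesE; apply: fin_bigcap_measurable => [|k _]; first exact: finite_finset.
exact: measurable_code.
Qed.

Let prob_codes l : fine (P [set w | codes w = l]) = \prod_k prob k (l k).
Proof.
rewrite codesE (iZ _ (fun k => @measurable_grid_cell R N (l k))).
have probE k : P (Z k @^-1` [set z | grid_code N z = l k]) = (prob k (l k))%:E.
  by rewrite /prob fineK // fin_num_measure //; exact: measurable_code.
rewrite (eq_bigr _ (fun k _ => probE k)) prodEFin /=.
by apply: eq_bigl => k; rewrite inE.
Qed.

Let rep_power_mean (k : 'I_m) (e : int) : C := \sum_a grid_rep R a ^ e * (prob k a)%:C.

Let norm_rep_power_mean k e : `|rep_power_mean k e| <= 1.
Proof.
apply: le_trans (ler_norm_sum _ _ _) _.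
have sum1 : \sum_a prob k a = 1.
  have := expectation_finite_valued P (measurable_code k) (fun=> 1 : R).
  rewrite Rintegral_cst // [X in fine X](probability_setT P) mulr1.
  by under eq_bigr do rewrite mul1r.
rewrite -[leRHS]/((1 : R)%:C) -sum1 rmorph_sum /=; apply: ler_sum => a _.
rewrite normrM norm_exprz ?norm_grid_rep // mul1r.
rewrite normc_def /= expr0n addr0 sqrtr_sqr ger0_norm ?lexx //.
by rewrite fine_ge0 // measure_ge0.
Qed.

(** This is close to the mean of the e-th power of a uniform point, which is 0. *)
Let rep_power_mean_small k (e : int) (c : C) : e != 0 ->
  `|complex.Re (c * rep_power_mean k e)| <= complex.Re `|c| * (2 / N%:R *+ absz e).
Proof.
move=> e0.
have -> : complex.Re (c * rep_power_mean k e) =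
    \int[P]_w complex.Re (c * grid_rep R (code k w) ^ e).
  rewrite (expectation_finite_valued P (measurable_code k)
    (fun a => complex.Re (c * grid_rep R a ^ e))).
  rewrite mulr_sumr raddf_sum /=; apply: eq_bigr => a _.
  by rewrite mulrA Re_mulr_real.
rewrite -[X in `|X|]subr0 -(expectation_uniform_exprz (uZ k) c e0).
have hZ := torus_map_uniform.
apply: (@expectation_close _ _ (complex.Re `|c|)).
- exact: (measurable_finite_valued (measurable_code k)
    (fun a => complex.Re (c * grid_rep R a ^ e))).
- exact: (cmeasM (cmeas_cst _ c) (cmeas_exprz e (uZ k).1 (cmeas_RV (Z k)))).1.
- move=> w; rewrite -lecR; apply: le_trans (normc_ge_Re _) _.
  by rewrite normrM norm_exprz ?norm_grid_rep // mulr1 RRe_real // normr_real.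
- move=> w; rewrite -raddfB -mulrBr; apply: norm_Re_mul.
  rewrite rmorphMn distrC; apply: le_trans (exprz_diff_le _ _ _) _.
  + exact: (uZ k).1.
  + exact: norm_grid_rep.
  + by rewrite lerMn2r orbC grid_rep_close //; exact: (uZ k).1.
Qed.

(** Replacing each coordinate by the representative of its cell changes the
    character by O(1/N). The mean of the discretized character
    factors by independence, with all factors in the unit disk and the one at a k with
    n k <> 0 of size O(1/N). *)
Lemma character_mean_bound (c : C) (n : {ffun 'I_m -> int}) : n != 0 ->
  `|\int[P]_w complex.Re (c * mon (torus_point w) n)| <=
  (complex.Re `|c| * (4 * \sum_k (absz (n k))%:R)) / N%:R.
Proof.
move=> n0; have [k0 nk0] : exists k, n k != 0.
  apply/existsP; apply: contraNT n0 => /existsPn h.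
  by apply/eqP/ffunP => k; rewrite ffunE; apply/eqP/negPn/h.
have hZ := torus_map_uniform.
have Re_norm_ge0 (x : C) : 0 <= complex.Re `|x|.
  by rewrite -lecR RRe_real ?normr_real //; exact: normr_ge0.
pose H (l : {ffun 'I_m -> cell}) : R := complex.Re (c * \prod_k grid_rep R (l k) ^ n k).
have EH : \int[P]_w H (codes w) = complex.Re (c * \prod_k rep_power_mean k (n k)).
  rewrite (expectation_finite_valued P measurable_codes H).
  rewrite bigA_distr_bigA /= mulr_sumr raddf_sum /=; apply: eq_bigr => l _.
  rewrite prob_codes big_split /= -rmorph_prod mulrA /H.
  by rewrite Re_mulr_real.
have small : `|\int[P]_w H (codes w)| <=
    complex.Re `|c| * (2 / N%:R * \sum_k (absz (n k))%:R).
  rewrite EH (bigD1 k0) // mulrA mulrAC.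
  apply: le_trans (rep_power_mean_small _ _ nk0) _; apply: ler_pM => //.
  - rewrite -lecR !RRe_real ?normr_real // normrM ler_piMr // normr_prod.
    by apply: numdomain.Num.Theory.prodr_ile1 => k _; rewrite normr_ge0 norm_rep_power_mean.
  - rewrite -mulr_natr ler_wpM2l ?divr_ge0 // (bigD1 k0) //= lerDl.
    by apply: sumr_ge0 => k _.
have close : `|\int[P]_w complex.Re (c * mon (torus_point w) n) - \int[P]_w H (codes w)| <=
    complex.Re `|c| * (2 / N%:R * \sum_k (absz (n k))%:R).
  apply: (@expectation_close _ _ (complex.Re `|c|)).
  - exact: (cmeasM (cmeas_cst _ c) (cmeas_mon hZ n)).1.
  - exact: measurable_finite_valued.
  - move=> w; rewrite -lecR; apply: le_trans (normc_ge_Re _) _.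
    by rewrite normrM norm_mon ?mulr1 ?RRe_real ?normr_real //; exact: hZ.1.
  - move=> w; rewrite -raddfB -mulrBr; apply: norm_Re_mul.
    apply: le_trans (prod_diff_le _ _ _) _.
    + by move=> k; rewrite norm_exprz //; exact: (uZ k).1.
    + by move=> k; rewrite norm_exprz // norm_grid_rep.
    rewrite mulr_sumr rmorph_sum; apply: ler_sum => k _.
    apply: le_trans (exprz_diff_le _ _ _) _.
    + exact: (uZ k).1.
    + exact: norm_grid_rep.
    rewrite -[leLHS]mulr_natr rmorphM rmorph_nat ler_wpM2r ?ler0n // ffunE.
    exact: (grid_rep_close N0 ((uZ k).1 w)).
set a := \int[P]_w _; set b := \int[P]_w H (codes w) in small close.
rewrite (_ : a = (a - b) + b); last by ring.
apply: le_trans (ler_normD _ _) _; apply: le_trans (lerD close small) _.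
by rewrite le_eqVlt; apply/orP; left; apply/eqP; field; rewrite pnatr_eq0 -lt0n.
Qed.

End Discretized.

Lemma independent_centered_characters : centered_characters P torus_point.
Proof.
move=> c n n0; apply/eqP; rewrite -normr_le0 leNgt; apply/negP => I0.
set I := `|_| in I0; pose K := complex.Re `|c| * (4 * \sum_k (absz (n k))%:R).
have KN N : (0 < N)%N -> I * N%:R <= K.
  move=> N0; rewrite -ler_pdivlMr ?ltr0n //; exact: character_mean_bound.
have K0 : 0 <= K by apply: le_trans (KN 1%N isT); rewrite mulr1 ltW.
have := archi_boundP (divr_ge0 K0 (ltW I0)).
rewrite ltr_pdivrMr // mulrC ltNge KN //.
Qed.

End Independent.

(** * Rational functions on the torus *)

Section RationalFunctions.
Variable R : realType.
Local Notation C := R[i].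

(** Two fractions P/Q = P'/Q' satisfy P' Q = P Q' as polynomials, hence at z. *)
Lemma rateval_quotient r (f : ratfun R r) (P Q : cpoly R r) (z : 'I_r -> C) :
  quotient_of f P Q -> meval z Q != 0 -> rateval f z = meval z P / meval z Q.
Proof.
move=> fPQ Qz; rewrite /rateval; case: xgetP => [w _ [P' [Q' [fPQ' Q'z ->]]]|h]; last first.
  by case: (h (meval z P / meval z Q)); exists P, Q.
have neq0 (S : cpoly R r) : meval z S != 0 -> FracField.tofrac S != 0.
  by move=> Sz; rewrite tofrac_eq0; apply: contraNneq Sz => ->; rewrite meval0.
have : FracField.tofrac (P' * Q) = FracField.tofrac (P * Q').
  rewrite !tofracM; apply/eqP; rewrite -eqr_div ?neq0 //.
  by rewrite -fPQ -fPQ'.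
move/eqP; rewrite tofrac_eq => /eqP/(congr1 (meval z)).
rewrite !mevalM => E; apply/eqP; rewrite eqr_div //; exact/eqP.
Qed.

Section Monomials.
Variables (m s : nat) (b : 'M[rat]_(m, s)).

Lemma trigpoly_Ztheta i : trigpoly (fun z : 'I_m -> C => Ztheta b z i).
Proof.
rewrite /Ztheta; case: (fintype.split i) => [k|j].
  pose e : {ffun 'I_m -> int} := [ffun l => (l == k)%:Z * (common_den b)%:Z].
  apply: eq_trigpoly (trigpoly_mon R e) => z _.
  rewrite /mon (bigD1 k) //= ffunE eqxx mul1r big1 ?mulr1 // => l lk.
  by rewrite ffunE (negbTE lk) mul0r expr0z.
apply: eq_trigpoly (trigpoly_mon R [ffun k => scaled_coef b k j]) => z _.
by apply: eq_bigr => k _; rewrite ffunE.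
Qed.

Lemma trigpoly_meval (Q : cpoly R (m + s)) :
  trigpoly (fun z : 'I_m -> C => meval (Ztheta b z) Q).
Proof.
have T : trigpoly (fun z : 'I_m -> C =>
    \sum_(a <- msupp Q) mcoeff a Q * \prod_i Ztheta b z i ^+ a i).
  apply: trigpoly_sum => a.
  apply: trigpolyM (trigpoly_cst _) _; apply: trigpoly_prod => i.
  exact/trigpolyX/trigpoly_Ztheta.
by apply: eq_trigpoly T => z _; rewrite mevalE.
Qed.

Lemma torus_Ztheta (z : 'I_m -> C) : torus z -> torus (Ztheta b z).
Proof.
move=> tz i; rewrite /Ztheta; case: (fintype.split i) => [k|j].
  by rewrite normrX tz expr1n.
by rewrite normr_prod big1 // => k _; rewrite norm_exprz.
Qed.

Lemma common_den_gt0 : (0 < common_den b)%N.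
Proof.
have lcm0 (x y : nat) : (0 < x -> 0 < y -> 0 < lcmn x y)%N.
  by move=> ? ?; rewrite lcmn_gt0; apply/andP.
apply: (big_ind (fun x => 0 < x)%N) => // k _; apply: (big_ind (fun x => 0 < x)%N) => // j _.
by rewrite absz_gt0 denq_neq0.
Qed.

Lemma scaled_coefE k j : (scaled_coef b k j)%:~R = (common_den b)%:R * b k j.
Proof.
rewrite /scaled_coef numqK //.
have /dvdnP[e ->] : (absz (denq (b k j)) %| common_den b)%N.
  apply: (@dvdn_trans (\big[lcmn/1%N]_(j < s) absz (denq (b k j)))%N).
    by rewrite (bigD1 j) //= dvdn_lcml.
  by rewrite /common_den (bigD1 k) //= dvdn_lcml.
rewrite natrM -mulrA; apply: rpredM; first exact: rpred_nat.
have -> : (absz (denq (b k j)))%:R = (denq (b k j))%:~R :> rat.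
  by rewrite -[in RHS](gez0_abs (denq_ge0 _)).
rewrite -{2}(divq_num_den (b k j)) mulrCA mulfV ?mulr1 ?rpred_int //.
by rewrite intr_eq0 denq_neq0.
Qed.

Variable theta : 'I_(m + s) -> R.
Hypothesis theta_b : forall j : 'I_s,
  theta (rshift m j) = \sum_(k < m) ratr (b k j) * theta (lshift s k).

(** A curve on the m-dimensional torus which Ztheta maps to the curve of
    the e^(i theta_j y); hence the division by d, undone by the exponents of Ztheta. *)
Definition flow (y : measurableTypeR R) (k : 'I_m) : C :=
  expi (theta (lshift s k) / (common_den b)%:R * y).

Lemma Ztheta_flow y : Ztheta b (flow y) = fun i => expi (theta i * y).
Proof.
have d0 : (common_den b)%:R != 0 :> R by rewrite pnatr_eq0 -lt0n common_den_gt0.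
apply/funext => i; rewrite /Ztheta /flow -{2}(splitK i).
case: (fintype.split i) => [k|j] /=.
  by rewrite -expiMn; congr expi; rewrite -[LHS]mulr_natr mulrAC divfK.
under eq_bigr do rewrite -expiMz.
rewrite -expi_sum theta_b; congr expi; rewrite mulr_suml; apply: eq_bigr => k _.
rewrite -mulrzr -(ratr_int R) scaled_coefE rmorphM /= ratr_nat.
by field.
Qed.

Lemma torus_map_flow : torus_map flow.
Proof.
split=> [y|k]; first exact: torus_expi.
have mx : measurable_fun setT (fun y : measurableTypeR R =>
    theta (lshift s k) / (common_den b)%:R * y).
  exact: mulrl_measurable.
split.
  exact: measurableT_comp (continuous_measurable_fun (@continuous_cos R)) mx.
exact: measurableT_comp (continuous_measurable_fun (@continuous_sin R)) mx.
Qed.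

Hypothesis theta_free : Qfree (fun k : 'I_m => theta (lshift s k)).

Lemma flow_character_average (c : C) (n : {ffun 'I_m -> int}) : n != 0 ->
  time_average (fun y => complex.Re (c * mon (flow y) n)) X @[X --> +oo] --> (0 : R).
Proof.
move=> n0; pose l := \sum_k theta (lshift s k) / (common_den b)%:R * (n k)%:~R.
have d0 : (common_den b)%:R != 0 :> R by rewrite pnatr_eq0 -lt0n common_den_gt0.
have l0 : l != 0.
  apply: contraNneq n0 => l0; apply/eqP/ffunP => k; rewrite ffunE.
  have : \sum_k ratr (n k)%:~R * theta (lshift s k) = 0.
    transitivity ((common_den b)%:R * l); last by rewrite l0 mulr0.
    rewrite /l mulr_sumr; apply: eq_bigr => i _.
    by rewrite ratr_int; field.
  by move/theta_free/(_ k)/eqP; rewrite intr_eq0 => /eqP.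
rewrite (_ : (fun y => complex.Re (c * mon (flow y) n)) = fun y => complex.Re (c * expi (l * y))).
  exact: average_character.
apply/funext => y; rewrite mon_expi mulr_suml; congr (complex.Re (c * expi _)).
by apply: eq_bigr => k _; rewrite -mulrzr mulrAC.
Qed.

End Monomials.

(** Multiplying the difference of the quotients by |q q'|^2 > 0 clears the
    denominators within polynomials in a, q, a', q' and their conjugates. *)
Lemma Re_div_lt (a q a' q' : C) : q != 0 -> q' != 0 ->
  (complex.Re (a' / q') < complex.Re (a / q)) =
  (0 < complex.Re ((a * q' - a' * q) * (q * q')^*%C)).
Proof.
move=> q0 q'0.
have -> : (a * q' - a' * q) * (q * q')^*%C = (a / q - a' / q') * `|q * q'| ^+ 2.
  rewrite sqr_normc mulrA; congr (_ * _); field.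
  by rewrite q0 q'0.
have n0 : 0 < `|q * q'| by rewrite normr_gt0 mulf_neq0.
have -> : `|q * q'| ^+ 2 = (complex.Re `|q * q'| ^+ 2)%:C.
  by rewrite -{1}[`|_|]RRe_real ?normr_real // -(rmorphXn (real_complex R)).
rewrite Re_mulr_real pmulr_lgt0 ?raddfB ?subr_gt0 //.
by rewrite exprn_gt0 // -ltcR RRe_real ?normr_real.
Qed.

End RationalFunctions.

Theorem theorem1p6 (R : realType) (m s : nat) (theta : 'I_(m + s) -> R)
    (b : 'M[rat]_(m, s))
    (theta_basis : Qbasis (fun k : 'I_m => theta (lshift s k)) (Qspan theta))
    (theta_b : forall j : 'I_s,
      theta (rshift m j) = \sum_(k < m) ratr (b k j) * theta (lshift s k))
    (d : measure_display) (W : measurableType d) (P : probability W R)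
    (Z : 'I_m -> {RV P >-> borelC R})
    (Z_uniform : forall k, uniform_on_circle (Z k))
    (Z_indep : mutually_independent Z)
    (D : nat) (f : 'I_D -> ratfun R (m + s))
    (f_no_pole : forall j, no_pole_on_torus (f j))
    (f_real : forall j, real_on_torus (f j)) :
  let F (j : 'I_D) (t : R) : R :=
    complex.Re (rateval (f j) (fun i => expi (theta i * t))) in
  let fZ (w : W) (j : 'I_D) : R :=
    complex.Re (rateval (f j) (Ztheta b (fun k => Z k w))) in
  let average (X : R) : R :=
    X^-1 * \int[lebesgue_measure]_(y in `[0, X])
             \1_decreasing_tuples (fun j => F j y) in
  average X @[X --> +oo] --> fine (P [set w | decreasing_tuples (fZ w)]).
Proof.
move=> F fZ average.
(* representations of the f j by quotients without poles on the torus *)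
have [p pP] := boolp.choice f_no_pole.
have [q pqP] := boolp.choice pP.
pose V := torus_point Z.
have hV : torus_map V by exact: torus_map_uniform.
have cV : centered_characters P V by exact: independent_centered_characters.
have theta_free : Qfree (fun k : 'I_m => theta (lshift s k)) by case: theta_basis.
pose U := flow b theta.
have hU : torus_map U by exact: torus_map_flow.
pose ev (A : cpoly R (m + s)) (z : 'I_m -> R[i]) := meval (Ztheta b z) A.
pose g (ij : 'I_D * 'I_D) (z : 'I_m -> R[i]) : R := complex.Re
  ((ev (p ij.1) z * ev (q ij.2) z - ev (p ij.2) z * ev (q ij.1) z) *
   (ev (q ij.1) z * ev (q ij.2) z)^*%C).
have gt ij : rtrig (g ij).
  have tev A : trigpoly (ev A) by exact: trigpoly_meval.
  apply/rtrig_Re/trigpolyM; last exact/trigpoly_conj/trigpolyM.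
  apply: eq_trigpoly (trigpolyD (trigpolyM (tev (p ij.1)) (tev (q ij.2)))
    (trigpolyM (trigpoly_cst (- 1)) (trigpolyM (tev (p ij.2)) (tev (q ij.1))))) => z _.
  by rewrite mulN1r.
pose r := [seq ij : 'I_D * 'I_D <- enum {: 'I_D * 'I_D} | (ij.1 < ij.2)%N].
have key z : torus z ->
    \1_decreasing_tuples (fun j => complex.Re (rateval (f j) (Ztheta b z))) =
    positive_all r g z :> R.
  move=> tz; rewrite indicE /positive_all; congr ((nat_of_bool _)%:R).
  have q0 j : ev (q j) z != 0 by apply: (pqP j).2; exact: torus_Ztheta.
  have fE j : rateval (f j) (Ztheta b z) = ev (p j) z / ev (q j) z.
    exact: rateval_quotient (pqP j).1 (q0 j).
  have gE i j : (0 < g (i, j) z) =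
      (complex.Re (rateval (f j) (Ztheta b z)) < complex.Re (rateval (f i) (Ztheta b z))).
    by rewrite !fE Re_div_lt.
  apply/idP/allP => [/set_mem dec [i j]|pos].
    by rewrite mem_filter /= gE => /andP[ij _]; exact: dec.
  apply/mem_set => i j ij; rewrite -gE; apply: pos.
  by rewrite mem_filter /= ij mem_enum.
have -> : average = time_average (positive_all r g \o U).
  apply/funext => X; congr (_ * _); apply: eq_Rintegral => y _ /=.
  by rewrite -(key _ (hU.1 y)) /F Ztheta_flow.
have -> : fine (P [set w | decreasing_tuples (fZ w)]) = \int[P]_w positive_all r g (V w).
  have mA : measurable [set w | decreasing_tuples (fZ w)].
    have := measurable_positive_all hV r gt measurableT (measurable_set1 1).
    rewrite setTI; congr measurable; apply/seteqP; split => w /=.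
      rewrite -(key _ (hV.1 w)) indicE.
      by case: (boolP (_ \in _)) => [/set_mem //|_ /eqP]; rewrite eq_sym oner_eq0.
    by move=> dec; rewrite -(key _ (hV.1 w)) indicE mem_set.
  transitivity (\int[P]_w \1_[set w | decreasing_tuples (fZ w)] w).
    by rewrite /Rintegral integral_indic // setIT.
  apply: eq_Rintegral => w _; rewrite -(key _ (hV.1 w)) !indicE.
  by congr ((nat_of_bool _)%:R); apply/idP/idP => /set_mem ?; exact/mem_set.
apply: time_average_positive => // c n n0.
exact: flow_character_average.
Qed.
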